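(* Let $N\ge 1$ be an integer and $-1<\gamma<1$. For each $\alpha>0$ let $f(\cdot;\alpha)$ be the profile defined in the context. There exists an increasing and unbounded sequence of exponents $$0<\alpha_0<\alpha_1<\alpha_2<\dots$$ such that, for every $k=0,1,2,\dots$, $$f(\eta;\alpha_k)\sim \eta^{\alpha_k-N}e^{-\frac{1+(-1)^k\gamma}{4}\eta^2}\qquad\text{as }\eta\to\infty,$$ and, for every $\alpha>0$ with $\alpha\ne\alpha_k$ for all $k$, $$f(\eta;\alpha)\sim\eta^{-\alpha}\qquad\text{as }\eta\to\infty.$$
   Context: Let $\sigma:\mathbb{R}\to\mathbb{R}$ be given by $\sigma(z)=-\frac{1-\gamma}{2}$ if $z>0$ and $\sigma(z)=-\frac{1+\gamma}{2}$ if $z\le 0$. For $\alpha>0$, the profile $f=f(\cdot;\alpha):[0,\infty)\to\mathbb{R}$ is the unique solution (of class $C^1$ on $[0,\infty)$ and $C^2$ on $(0,\infty)$) of the nonlinear Cauchy problem $$f''+\frac{N-1}{\eta}f'=\sigma(\alpha f+\eta f')\,(\alpha f+\eta f')\quad(\eta>0),\qquad f(0)=1,\quad f'(0)=0 .$$ Equivalently, $u_\alpha(x,t)=t^{-\alpha/2}f(\|x\|/\sqrt t;\alpha)$ is a similarity solution of $u_t+\gamma|u_t|=\Delta u$ in $\mathbb{R}^N\times(0,\infty)$, with the normalization $f(0)=1$. The notation $g(\eta)\sim h(\eta)$ as $\eta\to\infty$ means that $g(\eta)/h(\eta)$ converges to a nonzero real constant (which may be negative and may depend on $\alpha$, $N$,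 $\gamma$) as $\eta\to\infty$. *)

(* Defs.v *)
From Stdlib Require Import Reals.
From Coquelicot Require Import Coquelicot.
Open Scope R_scope.

Definition sigma_gamma (gamma z : R) : R :=
  if Rlt_dec 0 z then - ((1 - gamma) / 2) else - ((1 + gamma) / 2).

Definition nonneg_half (x : R) : Prop := 0 <= x.
Definition pos_half (x : R) : Prop := 0 < x.

(* Derivative relative to [D]: one-sided at the end points of an interval, so
   that the values of a profile at negative arguments are irrelevant. *)
Definition is_derive_within (D : R -> Prop) (f : R -> R) (x l : R) : Prop :=
  filterlim (fun y => (f y - f x) / (y - x)) (within D (locally' x)) (locally l).

(* [f1] and [f2] are the first and second derivatives of [f]; [f2] is only
   constrained on the open half-line. *)
Definition is_profile (N : nat) (gamma alpha : R) (f : R -> R) : Prop :=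
  exists f1 f2 : R -> R,
    (forall eta, 0 <= eta -> is_derive_within nonneg_half f eta (f1 eta)) /\
    continuous_on nonneg_half f1 /\
    (forall eta, 0 < eta -> is_derive f1 eta (f2 eta)) /\
    continuous_on pos_half f2 /\
    (forall eta, 0 < eta ->
       f2 eta + (INR N - 1) / eta * f1 eta =
       sigma_gamma gamma (alpha * f eta + eta * f1 eta)
         * (alpha * f eta + eta * f1 eta)) /\
    f 0 = 1 /\
    f1 0 = 0.

Definition sim_infty (g h : R -> R) : Prop :=
  exists l : R, l <> 0 /\ is_lim (fun eta => g eta / h eta) p_infty l.

(* Main.v *)
Require Import Defs.
From Stdlib Require Import Reals Lra Psatz Classical IndefiniteDescription.
From Coquelicot Require Import Coquelicot.
Open Scope R_scope.

(** The equation is positively homogeneous of degree one, so in polar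
    coordinates $f = \rho\cos\theta$, $f' = -\rho\sin\theta$ the angle solves a
    scalar equation by itself (Pruefer's substitution), and the whole statement
    is read off from $\theta$.

    Raising $\alpha$ raises the right-hand side of the angle equation, hence
    raises $\theta$ ([angle_comparison]), and it does so in a Lipschitz way
    ([angle_lipschitz]). At $\theta = k\pi + \pi/2$, a zero of $f$, one has
    $\theta' = 1$, so these levels are crossed only upwards
    ([angle_upcrossing]). Far out, the curve $\eta f'/f = -C$ with
    $C > \alpha$ is crossed only towards smaller $\theta$
    ([angle_downcrossing]). Hence each $\theta$ ends up, for some $k$, either
    between a zero level and that curve (a slow tail, where
    $\eta f'/f \to -\alpha$ and $f \sim \eta^{-\alpha}$), or between the curve and
    the next zero level (a fast tail); this is [tail_dichotomy].

    In a fast tail $f$ has the sign $(-1)^k$ and $\alpha f + \eta f'$ the opposite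
    one, so the equation is linear with drift $c\eta$,
    $c = (1 + (-1)^k\gamma)/2$. There $-f/f'$ satisfies a Riccati equation which
    is unstable as $\eta$ increases; since it stays $O(\eta)$ it must follow the
    only branch that does not escape ([unstable_nonpos]). This gives at once the
    expansion of $f'/f$ ([fast_rate]) and the fact that a given $k$ admits at most
    one exponent with a fast tail ([fast_unique]).

    Finally $\alpha_k$ is the supremum of the exponents for which $\theta$ never
    passes $k\pi + \pi/2$, that is, $f$ changes sign at most $k$ times. It exists
    because small exponents produce no zero ([trapped_open] at exponent 0, where
    $\theta = 0$) and large ones produce many ([many_half_turns]). Passing a level
    is an open condition, and so is being trapped behind the barrier; a slow tail
    or the wrong index $k$ would therefore persist beyond $\alpha_k$, which leaves
    only a fast tail of index exactly $k$ ([threshold_fast]). *)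

(** * Calculus on half-lines *)

(** [auto_derive] leaves eta-expanded derivatives of abstract functions; their
    values are supplied by hypotheses. *)
Ltac subst_derive H :=
  match type of H with
  | is_derive _ _ ?l =>
      match goal with
      | |- context [Derive ?h ?a] =>
          replace (Derive h a) with l by (symmetry; apply is_derive_unique, H)
      end
  end.

Lemma nonneg_derive_le (g dg : R -> R) (a b : R) :
  a <= b ->
  (forall x, a <= x <= b -> is_derive g x (dg x)) ->
  (forall x, a <= x <= b -> 0 <= dg x) -> g a <= g b.
Proof.
  intros Hab Hd Hp.
  destruct (MVT_gen g a b dg) as [c [Hc E]]; cbv zeta in *;
    rewrite ?Rmin_left, ?Rmax_right in * by lra.
  - intros x Hx; apply Hd; lra.
  - intros x Hx; apply continuity_pt_filterlim, (ex_derive_continuous g).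
    exists (dg x); apply Hd; lra.
  - specialize (Hp c Hc); nra.
Qed.

Lemma nonpos_derive_le (g dg : R -> R) (a b : R) :
  a <= b ->
  (forall x, a <= x <= b -> is_derive g x (dg x)) ->
  (forall x, a <= x <= b -> dg x <= 0) -> g b <= g a.
Proof.
  intros Hab Hd Hp.
  assert (- g a <= - g b); [|lra].
  apply (nonneg_derive_le (fun x => - g x) (fun x => - dg x)); trivial.
  - intros x Hx; apply (is_derive_opp g), Hd, Hx.
  - intros x Hx; specialize (Hp x Hx); lra.
Qed.

Lemma ex_derive_nbhd (g : R -> R) (x e : R) :
  ex_derive g x -> 0 < e ->
  exists d, 0 < d /\ forall y, Rabs (y - x) < d -> Rabs (g y - g x) < e.
Proof.
  intros Hg He.
  destruct (proj1 (filterlim_locally _ _) (ex_derive_continuous g x Hg)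
              (mkposreal e He)) as [d Hd].
  exists d; split; [apply cond_pos|intros y Hy; apply (Hd y Hy)].
Qed.

Lemma first_hit (g : R -> R) (a b : R) :
  a <= b -> (forall x, a <= x <= b -> ex_derive g x) ->
  g a < 0 -> 0 <= g b ->
  exists c, a < c <= b /\ g c = 0 /\ forall x, a <= x < c -> g x < 0.
Proof.
  intros Hab Hg Ha Hb.
  set (E := fun x => a <= x <= b /\ forall y, a <= y <= x -> g y < 0).
  assert (Ea : E a).
  { split; [lra|]. intros y Hy; replace y with a by lra; exact Ha. }
  destruct (completeness E) as [c [Hu Hl]].
  { exists b; intros x [Hx _]; lra. }
  { exists a; exact Ea. }
  assert (Hac : a <= c) by (apply Hu, Ea).
  assert (Hcb : c <= b) by (apply Hl; intros x [Hx _]; lra).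
  assert (Hlt : forall x, a <= x < c -> g x < 0).
  { intros x Hx. destruct (Rlt_dec (g x) 0) as [|Hn]; [trivial|].
    assert (c <= x); [|lra]. apply Hl; intros z [Hz Hz'].
    destruct (Rle_dec z x); [trivial|]. exfalso; apply Hn, Hz'; lra. }
  assert (Hgc : g c = 0).
  { destruct (Rtotal_order (g c) 0) as [Hn|[|Hp]]; [|trivial|]; exfalso.
    - destruct (ex_derive_nbhd g c (- g c)) as [d [Hd Hd']]; [apply Hg; lra|lra|].
      assert (c < b) by (destruct (Req_dec c b); [subst; lra|lra]).
      assert (HE : E (Rmin b (c + d / 2))).
      { pose proof (Rmin_l b (c + d / 2)); pose proof (Rmin_r b (c + d / 2)).
        split; [split; [apply Rmin_glb; lra|lra]|].
        intros y Hy; destruct (Rlt_dec y c); [apply Hlt; lra|].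
        specialize (Hd' y); rewrite Rabs_pos_eq in Hd' by lra.
        specialize (Hd' ltac:(lra)); apply Rabs_def2 in Hd'; lra. }
      apply Hu in HE. revert HE; unfold Rmin; destruct Rle_dec; lra.
    - destruct (ex_derive_nbhd g c (g c)) as [d [Hd Hd']]; [apply Hg; lra|lra|].
      assert (a < c) by (destruct (Req_dec a c); [subst; lra|lra]).
      set (y := Rmax a (c - d / 2)).
      assert (a <= y < c /\ c - d < y).
      { unfold y, Rmax; destruct Rle_dec; lra. }
      specialize (Hlt y ltac:(lra)).
      specialize (Hd' y); rewrite Rabs_left in Hd' by lra.
      specialize (Hd' ltac:(lra)); apply Rabs_def2 in Hd'; lra. }
  exists c; repeat split; trivial.
  destruct (Req_dec a c); [subst; lra|lra].
Qed.

Lemma ex_derive_reflect (g : R -> R) (x : R) :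
  ex_derive g (- x) -> ex_derive (fun y => - g (- y)) x.
Proof. intros [l Hl]. auto_derive. exists l; exact Hl. Qed.

Lemma last_hit (g : R -> R) (a b : R) :
  a <= b -> (forall x, a <= x <= b -> ex_derive g x) ->
  g a <= 0 -> 0 < g b ->
  exists c, a <= c < b /\ g c = 0 /\ forall x, c < x <= b -> 0 < g x.
Proof.
  intros Hab Hg Ha Hb.
  destruct (first_hit (fun x => - g (- x)) (- b) (- a)) as [c [Hc [E Hn]]].
  - lra.
  - intros x Hx; apply ex_derive_reflect, Hg; lra.
  - rewrite Ropp_involutive; lra.
  - rewrite Ropp_involutive; lra.
  - exists (- c); repeat split; try lra.
    intros x Hx; specialize (Hn (- x) ltac:(lra)).
    rewrite Ropp_involutive in Hn; lra.
Qed.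

(** If the conclusion failed, a positive level strictly between the two values
    would be exceeded from some last moment on; from then on $E > 0$, so $E$ is
    nonincreasing and cannot end above that level. The sign condition is asked
    for only where $E > 0$, which is what differential inequalities provide. *)
Lemma decay_while_pos (E dE : R -> R) (x b : R) :
  x <= b -> (forall y, x <= y <= b -> is_derive E y (dE y)) ->
  (forall y, x <= y <= b -> 0 < E y -> dE y <= 0) ->
  0 < E b -> E b <= E x.
Proof.
  intros Hxb Hd Hs Hb.
  destruct (Rle_dec (E b) (E x)) as [|Hn]; [trivial|exfalso].
  set (m := (Rmax 0 (E x) + E b) / 2).
  assert (Hm : 0 < m < E b /\ E x <= m).
  { unfold m, Rmax; destruct Rle_dec; lra. }
  destruct (last_hit (fun y => E y - m) x b) as [c [Hc [Ec Hp]]]; try lra.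
  { intros y Hy; specialize (Hd y Hy). auto_derive; exists (dE y); exact Hd. }
  assert (E b <= E c); [|lra].
  apply (nonpos_derive_le E dE); [lra| |].
  - intros y Hy; apply Hd; lra.
  - intros y Hy; apply Hs; [lra|].
    destruct (Req_dec y c); [subst; lra|specialize (Hp y ltac:(lra)); lra].
Qed.

Lemma growth_while_pos (E dE : R -> R) (a x : R) :
  a <= x -> (forall y, a <= y <= x -> is_derive E y (dE y)) ->
  (forall y, a <= y <= x -> 0 < E y -> 0 <= dE y) ->
  0 < E a -> E a <= E x.
Proof.
  intros Hax Hd Hs Ha.
  pose proof (decay_while_pos (fun y => E (- y)) (fun y => - dE (- y)) (- x) (- a))
    as H; cbv beta in H; rewrite !Ropp_involutive in H.
  apply H; trivial; [lra| |].
  - intros y Hy. specialize (Hd (- y) ltac:(lra)).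
    auto_derive; [exists (dE (- y)); exact Hd|].
    subst_derive Hd; ring.
  - intros y Hy Hp. specialize (Hs (- y) ltac:(lra) Hp); lra.
Qed.

(** At a first zero reached from below the derivative is at least 0. *)
Lemma barrier (D dD : R -> R) (a b : R) :
  a <= b -> (forall x, a <= x <= b -> is_derive D x (dD x)) ->
  (forall x, a <= x <= b -> D x = 0 -> dD x < 0) ->
  D a < 0 -> D b < 0.
Proof.
  intros Hab Hd Hs Ha.
  destruct (Rlt_dec (D b) 0) as [|Hn]; [trivial|exfalso].
  destruct (first_hit D a b) as [c [Hc [Ec Hl]]]; try lra.
  { intros x Hx; exists (dD x); apply Hd, Hx. }
  specialize (Hs c ltac:(lra) Ec); specialize (Hd c ltac:(lra)).
  apply is_derive_Reals in Hd.
  destruct (Hd (- dD c) ltac:(lra)) as [d Hd'].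
  set (h := - Rmin ((c - a)) (d / 2)).
  pose proof (cond_pos d).
  assert (Hh : h < 0 /\ a <= c + h < c /\ - h < d).
  { unfold h, Rmin; destruct Rle_dec; lra. }
  specialize (Hd' h ltac:(lra)); rewrite Rabs_left in Hd' by lra.
  specialize (Hd' ltac:(lra)); apply Rabs_def2 in Hd'.
  specialize (Hl (c + h) ltac:(lra)); rewrite Ec in Hd'.
  assert (0 < (D (c + h) - 0) / h).
  { replace ((D (c + h) - 0) / h) with (- D (c + h) / - h) by (field; lra).
    apply Rdiv_lt_0_compat; lra. }
  lra.
Qed.

(** Starting on the barrier is harmless: the derivative there pushes $D$ below 0
    at once. *)
Lemma barrier_strict (D dD : R -> R) (a b : R) :
  a < b -> (forall x, a <= x <= b -> is_derive D x (dD x)) ->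
  (forall x, a <= x <= b -> D x = 0 -> dD x < 0) ->
  D a <= 0 -> D b < 0.
Proof.
  intros Hab Hd Hs Ha.
  destruct (Req_dec (D a) 0) as [E|]; [|apply (barrier D dD a b); trivial; lra].
  pose proof (Hs a ltac:(lra) E) as Hsa; pose proof (Hd a ltac:(lra)) as Hda.
  apply is_derive_Reals in Hda.
  destruct (Hda (- dD a) ltac:(lra)) as [d Hd'].
  pose proof (cond_pos d).
  set (h := Rmin (b - a) (d / 2)).
  assert (Hh : 0 < h < d /\ a + h <= b).
  { unfold h, Rmin; destruct Rle_dec; lra. }
  specialize (Hd' h ltac:(lra)); rewrite Rabs_pos_eq in Hd' by lra.
  specialize (Hd' ltac:(lra)); apply Rabs_def2 in Hd'; rewrite E in Hd'.
  apply (barrier D dD (a + h) b); [lra| | |].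
  - intros x Hx; apply Hd; lra.
  - intros x Hx; apply Hs; lra.
  - assert (H1 : (D (a + h) - 0) / h < 0) by lra.
    apply Rnot_le_lt; intros H2.
    assert (0 <= (D (a + h) - 0) / h) by (apply Rdiv_le_0_compat; lra). lra.
Qed.

Definition vanishes_at_0 (D : R -> R) : Prop :=
  forall e, 0 < e -> exists d, 0 < d /\ forall x, 0 < x < d -> Rabs (D x) < e.

(** Gronwall's inequality, started at the singular point 0 of the profile
    equation by a limit instead of a value, and with a differential inequality
    required only while $D > 0$. *)
Lemma gronwall_from_0 (D dD : R -> R) (L k b : R) :
  0 < b -> 0 < L -> 0 <= k -> vanishes_at_0 D ->
  (forall x, 0 < x <= b -> is_derive D x (dD x)) ->
  (forall x, 0 < x <= b -> 0 < D x -> dD x <= L * D x + k) ->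
  D b <= k / L * exp (L * b).
Proof.
  intros Hb HL Hk H0 Hd Hs.
  assert (HkL : 0 <= k / L) by (apply Rdiv_le_0_compat; lra).
  assert (Heb : 0 < exp (L * b)) by apply exp_pos.
  destruct (Rle_dec (D b) (k / L * exp (L * b))) as [|Hn]; [trivial|exfalso].
  (* the defect, which can only shrink while it is positive *)
  set (E := fun x => D x * exp (- (L * x)) + k / L * exp (- (L * x)) - k / L).
  assert (He : forall x, exp (L * x) * exp (- (L * x)) = 1).
  { intros x; rewrite <- exp_plus, Rplus_opp_r; apply exp_0. }
  assert (HdE : forall x, 0 < x <= b ->
    is_derive E x ((dD x - L * D x - k) * exp (- (L * x)))).
  { intros x Hx; specialize (Hd x Hx); unfold E.
    auto_derive; [exists (dD x); exact Hd|].
    subst_derive Hd; field; lra. }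
  assert (HDb : 0 < D b) by nra.
  assert (HEb : 0 < E b).
  { unfold E; pose proof (exp_pos (- (L * b))); specialize (He b). nra. }
  destruct (H0 (E b / 2) ltac:(lra)) as [d [Hd0 Hd1]].
  set (x := Rmin b (d / 2)).
  assert (Hx : 0 < x <= b /\ x < d).
  { unfold x, Rmin; destruct Rle_dec; lra. }
  assert (E b <= E x).
  { apply (decay_while_pos E (fun x => (dD x - L * D x - k) * exp (- (L * x))));
      [lra| | |lra].
    - intros y Hy; apply HdE; lra.
    - intros y Hy HEy.
      assert (Hey : 0 < exp (- (L * y)) <= 1).
      { split; [apply exp_pos|]. rewrite <- exp_0.
        destruct (Req_dec (L * y) 0) as [->|]; [rewrite Ropp_0; lra|].
        apply Rlt_le, exp_increasing; nra. }
      assert (0 < D y) by (unfold E in HEy; nra).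
      specialize (Hs y ltac:(lra) ltac:(lra)); nra. }
  assert (Hex : 0 < exp (- (L * x)) <= 1).
  { split; [apply exp_pos|]. rewrite <- exp_0.
    apply Rlt_le, exp_increasing; nra. }
  specialize (Hd1 x ltac:(lra)); apply Rabs_def2 in Hd1.
  unfold E in H at 2. nra.
Qed.

(** The instability principle behind all statements on fast tails: once
    positive, $D/x^3$ would be nondecreasing, which a quantity of size $x^2$
    cannot afford. *)
Lemma unstable_nonpos (D dD : R -> R) (r C : R) :
  0 < r -> (forall x, r <= x -> is_derive D x (dD x)) ->
  (forall x, r <= x -> 0 < D x -> 3 * D x / x <= dD x) ->
  (forall x, r <= x -> D x <= C * x ^ 2) ->
  forall x, r <= x -> D x <= 0.
Proof.
  intros Hr Hd Hs HC x Hx.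
  destruct (Rle_dec (D x) 0) as [|Hn]; [trivial|exfalso].
  assert (Hx3 : 0 < / x ^ 3) by (apply Rinv_0_lt_compat, pow_lt; lra).
  set (d := D x * / x ^ 3); assert (Hd0 : 0 < d) by (unfold d; nra).
  set (y := Rmax x (C / d + 1)).
  assert (Hy : x <= y /\ C / d + 1 <= y) by (split; [apply Rmax_l|apply Rmax_r]).
  assert (Hy3 : 0 < / y ^ 3) by (apply Rinv_0_lt_compat, pow_lt; lra).
  assert (H : d <= D y * / y ^ 3).
  { apply (growth_while_pos (fun x => D x * / x ^ 3)
             (fun x => (dD x - 3 * D x / x) * / x ^ 3)); [lra| | |exact Hd0].
    - intros z Hz; specialize (Hd z ltac:(lra)).
      auto_derive; [split; [exists (dD z); exact Hd|split; [|trivial]]|].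
      { assert (0 < z ^ 3) by (apply pow_lt; lra). simpl in *; lra. }
      subst_derive Hd; field; lra.
    - intros z Hz Hp.
      assert (0 < / z ^ 3) by (apply Rinv_0_lt_compat, pow_lt; lra).
      assert (0 < D z) by nra.
      specialize (Hs z ltac:(lra) ltac:(lra)); nra. }
  specialize (HC y ltac:(lra)).
  assert (H1 : d * y <= C).
  { apply Rmult_le_reg_r with (y ^ 2); [apply pow_lt; lra|].
    replace (d * y * y ^ 2) with (d * y ^ 3) by ring.
    apply Rle_trans with (D y); [|lra].
    apply Rmult_le_reg_r with (/ y ^ 3); [lra|].
    replace (d * y ^ 3 * / y ^ 3) with d by (field; lra). lra. }
  assert (H2 : C / d * d = C) by (field; lra). nra.
Qed.

(** While positive, $u x^2$ is nonincreasing. *)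
Lemma stable_decay (u du : R -> R) (r : R) :
  0 < r -> (forall x, r <= x -> is_derive u x (du x)) ->
  (forall x, r <= x -> 0 < u x -> du x <= - (2 * u x / x)) ->
  exists K, 0 <= K /\ forall x, r <= x -> u x <= K / x ^ 2.
Proof.
  intros Hr Hd Hs. exists (Rmax 0 (u r * r ^ 2)); split; [apply Rmax_l|].
  intros x Hx.
  assert (Hx2 : 0 < x ^ 2) by (apply pow_lt; lra).
  apply Rmult_le_reg_r with (x ^ 2); [exact Hx2|].
  unfold Rdiv; rewrite Rmult_assoc, Rinv_l, Rmult_1_r by lra.
  destruct (Rle_dec (u x * x ^ 2) 0) as [H|H].
  { apply Rle_trans with 0; [exact H|apply Rmax_l]. }
  apply Rle_trans with (u r * r ^ 2); [|apply Rmax_r].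
  apply (decay_while_pos (fun x => u x * x ^ 2)
           (fun x => (du x + 2 * u x / x) * x ^ 2)); [lra| | |lra].
  - intros z Hz; specialize (Hd z ltac:(lra)).
    auto_derive; [exists (du z); exact Hd|].
    subst_derive Hd; field; lra.
  - intros z Hz Hp. assert (0 < z ^ 2) by (apply pow_lt; lra).
    assert (0 < u z) by nra.
    specialize (Hs z ltac:(lra) ltac:(lra)); nra.
Qed.

Lemma is_lim_of_derive_bound (g dg : R -> R) (r K : R) :
  0 < r -> (forall x, r <= x -> is_derive g x (dg x)) ->
  (forall x, r <= x -> Rabs (dg x) <= K / x ^ 2) ->
  exists l : R, is_lim g p_infty l.
Proof.
  intros Hr Hd HK.
  (* g + K/x decreases and g - K/x increases, and they differ by 2K/x *)
  assert (Hbnd : forall x y, r <= x -> x <= y ->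
                   Rabs (g y - g x) <= K / x - K / y).
  { intros x y Hx Hy. apply Rabs_le; split.
    - assert (g x - K / x <= g y - K / y); [|lra].
      apply (nonneg_derive_le (fun z => g z - K / z) (fun z => dg z + K / z ^ 2));
        [lra| |].
      + intros z Hz; specialize (Hd z ltac:(lra)).
        auto_derive; [split; [exists (dg z); exact Hd|split; [lra|trivial]]|].
        subst_derive Hd; field; lra.
      + intros z Hz; specialize (HK z ltac:(lra)).
        apply Rabs_le_between in HK; lra.
    - assert (g y + K / y <= g x + K / x); [|lra].
      apply (nonpos_derive_le (fun z => g z + K / z) (fun z => dg z - K / z ^ 2));
        [lra| |].
      + intros z Hz; specialize (Hd z ltac:(lra)).
        auto_derive; [split; [exists (dg z); exact Hd|split; [lra|trivial]]|].
        subst_derive Hd; field; lra.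
      + intros z Hz; specialize (HK z ltac:(lra)).
        apply Rabs_le_between in HK; lra. }
  assert (HK0 : 0 <= K).
  { pose proof (Rle_trans _ _ _ (Rabs_pos _) (HK r (Rle_refl r))) as H.
    assert (0 < r ^ 2) by (apply pow_lt; lra).
    replace K with (K / r ^ 2 * r ^ 2) by (field; lra). nra. }
  destruct (completeness (fun z => exists x, r <= x /\ z = g x - K / x)) as [l [Hu Hl]].
  { exists (g r + K / r). intros z [x [Hx ->]].
    specialize (Hbnd r x (Rle_refl r) Hx). apply Rabs_le_between in Hbnd.
    assert (0 <= K / x) by (apply Rdiv_le_0_compat; lra). lra. }
  { exists (g r - K / r), r; split; [lra|trivial]. }
  exists l. apply is_lim_spec; intros [e He]; simpl.
  exists (Rmax r (2 * K / e)); intros x Hx.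
  assert (Hx1 : r <= x /\ 2 * K / e < x).
  { pose proof (Rmax_l r (2 * K / e)); pose proof (Rmax_r r (2 * K / e)); lra. }
  assert (Hl1 : g x - K / x <= l) by (apply Hu; exists x; split; [lra|trivial]).
  assert (Hl2 : l <= g x + K / x).
  { apply Hl; intros z [y [Hy ->]].
    destruct (Rle_dec x y) as [Hxy|Hxy].
    - specialize (Hbnd x y ltac:(lra) Hxy). apply Rabs_le_between in Hbnd.
      assert (0 <= K / y) by (apply Rdiv_le_0_compat; lra). lra.
    - specialize (Hbnd y x ltac:(lra) ltac:(lra)). apply Rabs_le_between in Hbnd.
      assert (0 <= K / x) by (apply Rdiv_le_0_compat; lra). lra. }
  assert (K / x < e).
  { apply Rmult_lt_reg_r with x; [lra|].
    replace (K / x * x) with K by (field; lra).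
    assert (2 * K / e * e = 2 * K) by (field; lra). nra. }
  apply Rabs_def1; lra.
Qed.

(** * The angle equation and its dependence on the exponent *)

(** The right-hand side of the profile equation as a function of
    $z = \alpha f + \eta f'$. *)
Definition reaction (gamma z : R) : R := sigma_gamma gamma z * z.

Lemma reactionE gamma z : reaction gamma z = - (z - gamma * Rabs z) / 2.
Proof.
  unfold reaction, sigma_gamma; destruct Rlt_dec as [H|H].
  - rewrite Rabs_pos_eq; lra.
  - rewrite Rabs_left1; lra.
Qed.

Lemma reaction_scale gamma r z :
  0 <= r -> reaction gamma (r * z) = r * reaction gamma z.
Proof.
  intros Hr; rewrite !reactionE, Rabs_mult, (Rabs_pos_eq r) by lra; field.
Qed.

Lemma reaction_opp gamma z : reaction gamma (- z) = - reaction (- gamma) z.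
Proof. rewrite !reactionE, Rabs_Ropp; field. Qed.

Lemma reaction_decr gamma u v : -1 < gamma < 1 -> u <= v ->
  0 <= reaction gamma u - reaction gamma v <= v - u.
Proof.
  intros Hg Huv; rewrite !reactionE.
  unfold Rabs; destruct (Rcase_abs u), (Rcase_abs v); nra.
Qed.

Lemma reaction_lip gamma u v : -1 < gamma < 1 ->
  Rabs (reaction gamma u - reaction gamma v) <= Rabs (u - v).
Proof.
  intros Hg; destruct (Rle_dec u v) as [H|H].
  - pose proof (reaction_decr gamma u v Hg H).
    rewrite Rabs_pos_eq, Rabs_left1; lra.
  - pose proof (reaction_decr gamma v u Hg ltac:(lra)).
    rewrite Rabs_left1, Rabs_pos_eq; lra.
Qed.

Lemma reaction_abs_le gamma z : -1 < gamma < 1 -> Rabs (reaction gamma z) <= Rabs z.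
Proof.
  intros Hg; pose proof (reaction_lip gamma z 0 Hg) as H.
  replace (reaction gamma 0) with 0 in H by (unfold reaction; ring).
  rewrite !Rminus_0_r in H; exact H.
Qed.

(** The smaller of the two values of $|\sigma|$. *)
Definition damping (gamma : R) : R := (1 - Rabs gamma) / 2.

Lemma damping_pos gamma : -1 < gamma < 1 -> 0 < damping gamma.
Proof. intros Hg; unfold damping, Rabs; destruct Rcase_abs; lra. Qed.

Lemma reaction_damping gamma z : -1 < gamma < 1 ->
  exists mu, damping gamma <= mu <= 1 /\ reaction gamma z = - mu * z.
Proof.
  intros Hg; exists (- sigma_gamma gamma z); split; [|unfold reaction; ring].
  unfold sigma_gamma, damping, Rabs; destruct Rcase_abs, Rlt_dec; lra.
Qed.

(** The right-hand side for $\theta' = (f'^2 - f f'')/(f^2 + f'^2)$ when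
    $f = \rho\cos\theta$ and $f' = -\rho\sin\theta$; the radius cancels because
    [reaction] is positively homogeneous. The dimension enters as a real
    number [n]. *)
Definition angle_field (n gamma alpha eta th : R) : R :=
  sin th ^ 2 - (n - 1) / eta * (sin th * cos th)
  - cos th * reaction gamma (alpha * cos th - eta * sin th).

Definition angle_ode (n gamma alpha : R) (th : R -> R) : Prop :=
  forall eta, 0 < eta -> is_derive th eta (angle_field n gamma alpha eta (th eta)).

Definition shooting_angle (n gamma alpha : R) (th : R -> R) : Prop :=
  angle_ode n gamma alpha th /\ vanishes_at_0 th.

Lemma sin_lip x y : y <= x -> - (x - y) <= sin x - sin y <= x - y.
Proof.
  intros H; split.
  - assert (y + sin y <= x + sin x); [|lra].
    apply (nonneg_derive_le (fun z => z + sin z) (fun z => 1 + cos z)); trivial.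
    + intros z _; auto_derive; trivial; ring.
    + intros z _; pose proof (COS_bound z); lra.
  - assert (y - sin y <= x - sin x); [|lra].
    apply (nonneg_derive_le (fun z => z - sin z) (fun z => 1 - cos z)); trivial.
    + intros z _; auto_derive; trivial; ring.
    + intros z _; pose proof (COS_bound z); lra.
Qed.

Lemma cos_lip x y : y <= x -> - (x - y) <= cos x - cos y <= x - y.
Proof.
  intros H; rewrite !cos_sin.
  pose proof (sin_lip (PI / 2 + x) (PI / 2 + y) ltac:(lra)); lra.
Qed.

Lemma reaction_part_lip gamma alpha eta x y :
  -1 < gamma < 1 -> 0 <= alpha -> 0 < eta -> y <= x ->
  cos y * reaction gamma (alpha * cos y - eta * sin y)
  - cos x * reaction gamma (alpha * cos x - eta * sin x)
  <= 2 * (alpha + eta) * (x - y).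
Proof.
  intros Hg Ha He Hxy.
  set (u := alpha * cos y - eta * sin y); set (v := alpha * cos x - eta * sin x).
  pose proof (COS_bound x); pose proof (COS_bound y).
  pose proof (SIN_bound x); pose proof (SIN_bound y).
  pose proof (sin_lip x y Hxy); pose proof (cos_lip x y Hxy).
  assert (Hu : - (alpha + eta) <= u <= alpha + eta) by (unfold u; nra).
  assert (Huv : - ((alpha + eta) * (x - y)) <= u - v <= (alpha + eta) * (x - y)).
  { replace (u - v) with (- alpha * (cos x - cos y) + eta * (sin x - sin y))
      by (unfold u, v; ring). nra. }
  assert (Hs : - (alpha + eta) <= reaction gamma u <= alpha + eta).
  { apply Rabs_le_between. eapply Rle_trans; [apply reaction_abs_le, Hg|].
    apply Rabs_le; lra. }
  assert (Hd : - ((alpha + eta) * (x - y)) <= reaction gamma u - reaction gamma v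
               <= (alpha + eta) * (x - y)).
  { apply Rabs_le_between. eapply Rle_trans; [apply reaction_lip, Hg|].
    apply Rabs_le; lra. }
  replace (cos y * reaction gamma u - cos x * reaction gamma v)
    with (- (cos x - cos y) * reaction gamma u
          + cos x * (reaction gamma u - reaction gamma v)) by ring.
  assert (- (cos x - cos y) * reaction gamma u <= (alpha + eta) * (x - y)) by nra.
  assert (cos x * (reaction gamma u - reaction gamma v) <= (alpha + eta) * (x - y))
    by nra.
  lra.
Qed.

(** The coefficient $(n-1)/\eta$ is unbounded at 0, but there it multiplies
    $-\sin(x-y)\cos(x+y)$, which has the favourable sign as long as both angles
    are at most $\pi/4$ in absolute value. So the one-sided Lipschitz constant is
    uniform down to the singular point. *)
Lemma angle_field_osl n gamma alpha d b eta x y :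
  1 <= n -> -1 < gamma < 1 -> 0 <= alpha -> 0 < d -> 0 < eta <= b -> y <= x ->
  d <= eta \/ (- (PI / 4) <= y /\ x <= PI / 4) ->
  angle_field n gamma alpha eta x - angle_field n gamma alpha eta y
  <= (1 + (n - 1) / d + 2 * (alpha + b)) * (x - y).
Proof.
  intros Hn Hg Ha Hd He Hxy Hor.
  pose proof (reaction_part_lip gamma alpha eta x y Hg Ha ltac:(lra) Hxy) as H1.
  assert (Hs : - (x - y) <= sin (x - y) <= x - y).
  { pose proof (sin_lip (x - y) 0 ltac:(lra)) as H; rewrite sin_0 in H; lra. }
  assert (H2 : sin x ^ 2 - sin y ^ 2 <= x - y).
  { replace (sin x ^ 2 - sin y ^ 2) with (sin (x - y) * sin (x + y)).
    - pose proof (SIN_bound (x + y)); nra.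
    - rewrite sin_minus, sin_plus.
      pose proof (sin2_cos2 x); pose proof (sin2_cos2 y); unfold Rsqr in *.
      replace (sin x ^ 2 - sin y ^ 2) with
        (sin x * sin x * (sin y * sin y + cos y * cos y)
         - (sin x * sin x + cos x * cos x) * (sin y * sin y)) by nra. ring. }
  assert (H3 : - ((n - 1) / eta * (sin x * cos x)) + (n - 1) / eta * (sin y * cos y)
               <= (n - 1) / d * (x - y)).
  { replace (- ((n - 1) / eta * (sin x * cos x)) + (n - 1) / eta * (sin y * cos y))
      with (- ((n - 1) / eta) * (sin (x - y) * cos (x + y))).
    2:{ rewrite sin_minus, cos_plus.
        pose proof (sin2_cos2 x) as Ex; pose proof (sin2_cos2 y) as Ey.
        unfold Rsqr in Ex, Ey.
        transitivity (- ((n - 1) / eta)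
          * (sin x * cos x * (sin y * sin y + cos y * cos y)
             - sin y * cos y * (sin x * sin x + cos x * cos x)));
          [|rewrite Ex, Ey]; ring. }
    assert (Hk : 0 <= (n - 1) / eta) by (apply Rdiv_le_0_compat; lra).
    assert (Hk' : 0 <= (n - 1) / d) by (apply Rdiv_le_0_compat; lra).
    destruct Hor as [Hde|[Hy Hx]].
    - assert ((n - 1) / eta <= (n - 1) / d).
      { apply Rmult_le_compat_l; [lra|]. apply Rinv_le_contravar; lra. }
      assert (- (x - y) <= sin (x - y) * cos (x + y)).
      { pose proof (COS_bound (x + y)); nra. }
      nra.
    - assert (0 <= sin (x - y)) by (apply sin_ge_0; lra).
      assert (0 <= cos (x + y)) by (apply cos_ge_0; lra).
      assert (0 <= sin (x - y) * cos (x + y)) by nra. nra. }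
  assert (2 * (alpha + eta) * (x - y) <= 2 * (alpha + b) * (x - y)) by nra.
  unfold angle_field; lra.
Qed.

(** [reaction] is nonincreasing and 1-Lipschitz, and the shift of its argument
    is multiplied by $\cos\theta$ twice, so signs do not matter. *)
Lemma angle_field_alpha n gamma alpha beta eta th :
  -1 < gamma < 1 -> alpha <= beta ->
  angle_field n gamma alpha eta th <= angle_field n gamma beta eta th
  <= angle_field n gamma alpha eta th + (beta - alpha).
Proof.
  intros Hg Hab; unfold angle_field.
  set (c := cos th); set (e := eta * sin th).
  assert (Hc : -1 <= c <= 1) by apply COS_bound.
  assert (0 <= c * (reaction gamma (alpha * c - e) - reaction gamma (beta * c - e))
          <= beta - alpha); [|lra].
  destruct (Rle_dec 0 c).
  - pose proof (reaction_decr gamma (alpha * c - e) (beta * c - e) Hg ltac:(nra)).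
    split; nra.
  - pose proof (reaction_decr gamma (beta * c - e) (alpha * c - e) Hg ltac:(nra)).
    split; nra.
Qed.

(** For the exponent 0 the profile is the constant 1. Comparing with it
    bounds all angles from below and controls small exponents. *)
Lemma zero_shooting_angle n gamma : shooting_angle n gamma 0 (fun _ => 0).
Proof.
  split.
  - intros eta He. replace (angle_field n gamma 0 eta 0) with 0.
    + apply (is_derive_const 0 eta).
    + unfold angle_field; rewrite sin_0, cos_0.
      replace (0 * 1 - eta * 0) with 0 by ring. unfold reaction; ring.
  - intros e He; exists 1; split; [lra|].
    intros x _; rewrite Rabs_R0; exact He.
Qed.

Lemma vanishes_sub D1 D2 :
  vanishes_at_0 D1 -> vanishes_at_0 D2 -> vanishes_at_0 (fun x => D1 x - D2 x).
Proof.
  intros H1 H2 e He.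
  destruct (H1 (e / 2) ltac:(lra)) as [d1 [Hd1 H1']].
  destruct (H2 (e / 2) ltac:(lra)) as [d2 [Hd2 H2']].
  exists (Rmin d1 d2); split; [apply Rmin_glb_lt; trivial|].
  intros x Hx; pose proof (Rmin_l d1 d2); pose proof (Rmin_r d1 d2).
  specialize (H1' x ltac:(lra)); specialize (H2' x ltac:(lra)).
  apply Rabs_def2 in H1'; apply Rabs_def2 in H2'; apply Rabs_def1; lra.
Qed.

Lemma angle_comparison n gamma alpha beta th1 th2 :
  1 <= n -> -1 < gamma < 1 -> 0 <= alpha <= beta ->
  shooting_angle n gamma alpha th1 -> shooting_angle n gamma beta th2 ->
  forall eta, 0 < eta -> th1 eta <= th2 eta.
Proof.
  intros Hn Hg Hab [Ho1 Hv1] [Ho2 Hv2] b Hb.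
  pose proof PI_RGT_0 as HPI.
  destruct (Hv1 (PI / 4) ltac:(lra)) as [d1 [Hd1 Hs1]].
  destruct (Hv2 (PI / 4) ltac:(lra)) as [d2 [Hd2 Hs2]].
  set (d := Rmin d1 d2).
  assert (Hd : 0 < d /\ d <= d1 /\ d <= d2).
  { unfold d; split; [apply Rmin_glb_lt; trivial|split; [apply Rmin_l|apply Rmin_r]]. }
  set (L := 1 + (n - 1) / d + 2 * (beta + b)).
  assert (HL : 0 < L).
  { assert (0 <= (n - 1) / d) by (apply Rdiv_le_0_compat; lra). unfold L; lra. }
  pose proof (gronwall_from_0 (fun x => th1 x - th2 x)
    (fun x => angle_field n gamma alpha x (th1 x) - angle_field n gamma beta x (th2 x))
    L 0 b Hb HL (Rle_refl 0) (vanishes_sub _ _ Hv1 Hv2)) as H.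
  assert (th1 b - th2 b <= 0 / L * exp (L * b)); [apply H|].
  - intros x Hx; apply (is_derive_minus th1 th2); [apply Ho1|apply Ho2]; lra.
  - intros x Hx Hp.
    pose proof (angle_field_alpha n gamma alpha beta x (th1 x) Hg ltac:(lra)).
    pose proof (angle_field_osl n gamma beta d b x (th1 x) (th2 x) Hn Hg
                  ltac:(lra) ltac:(lra) Hx ltac:(lra)) as Ho.
    fold L in Ho. enough (d <= x \/ - (PI / 4) <= th2 x /\ th1 x <= PI / 4) by lra.
    destruct (Rle_dec d x); [now left|right].
    specialize (Hs1 x ltac:(lra)); specialize (Hs2 x ltac:(lra)).
    apply Rabs_def2 in Hs1; apply Rabs_def2 in Hs2; lra.
  - unfold Rdiv in *; lra.
Qed.

Lemma shooting_angle_nonneg n gamma alpha th :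
  1 <= n -> -1 < gamma < 1 -> 0 <= alpha -> shooting_angle n gamma alpha th ->
  forall eta, 0 < eta -> 0 <= th eta.
Proof.
  intros Hn Hg Ha Hs eta He.
  apply (angle_comparison n gamma 0 alpha (fun _ => 0) th Hn Hg); trivial; [lra|].
  apply zero_shooting_angle.
Qed.

Lemma angle_lipschitz n gamma M thM b :
  1 <= n -> -1 < gamma < 1 -> 0 <= M -> shooting_angle n gamma M thM -> 0 < b ->
  exists K, 0 < K /\
    forall alpha beta th1 th2, 0 <= alpha <= beta -> beta <= M ->
    shooting_angle n gamma alpha th1 -> shooting_angle n gamma beta th2 ->
    th2 b - th1 b <= K * (beta - alpha).
Proof.
  intros Hn Hg HM HsM Hb.
  pose proof PI_RGT_0 as HPI.
  (* all angles lie between 0 and the one for M, hence are uniformly small at 0 *)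
  destruct (proj2 HsM (PI / 4) ltac:(lra)) as [d [Hd Hs]].
  set (L := 1 + (n - 1) / d + 2 * (M + b)).
  assert (HL : 0 < L).
  { assert (0 <= (n - 1) / d) by (apply Rdiv_le_0_compat; lra). unfold L; lra. }
  pose proof (exp_pos (L * b)) as Hexp.
  exists (/ L * exp (L * b)); split.
  { apply Rmult_lt_0_compat; [apply Rinv_0_lt_compat|]; trivial. }
  intros alpha beta th1 th2 Hab HbM Hs1 Hs2.
  pose proof (gronwall_from_0 (fun x => th2 x - th1 x)
    (fun x => angle_field n gamma beta x (th2 x) - angle_field n gamma alpha x (th1 x))
    L (beta - alpha) b Hb HL ltac:(lra)
    (vanishes_sub _ _ (proj2 Hs2) (proj2 Hs1))) as H.
  assert (th2 b - th1 b <= (beta - alpha) / L * exp (L * b)); [apply H|].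
  - intros x Hx; apply (is_derive_minus th2 th1);
      [apply (proj1 Hs2)|apply (proj1 Hs1)]; lra.
  - intros x Hx Hp.
    pose proof (angle_field_alpha n gamma alpha beta x (th1 x) Hg ltac:(lra)).
    pose proof (angle_field_osl n gamma beta d b x (th2 x) (th1 x) Hn Hg
                  ltac:(lra) ltac:(lra) Hx ltac:(lra)) as Ho.
    enough (H1 : d <= x \/ - (PI / 4) <= th1 x /\ th2 x <= PI / 4).
    { specialize (Ho H1). unfold L. nra. }
    destruct (Rle_dec d x); [now left|right].
    pose proof (shooting_angle_nonneg n gamma alpha th1 Hn Hg ltac:(lra) Hs1 x ltac:(lra)).
    pose proof (angle_comparison n gamma beta M th2 thM Hn Hg ltac:(lra) Hs2 HsM x ltac:(lra)).
    specialize (Hs x ltac:(lra)); apply Rabs_def2 in Hs; lra.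
  - unfold Rdiv in *; lra.
Qed.

(** * Barriers, the two kinds of tail, and many half-turns *)

(** A half-turn replaces $f$ by $-f$, which exchanges the two values of
    $\sigma$, that is, $\gamma$ and $-\gamma$. This is where the parity of $k$ in the
    Gaussian rate comes from, and it reduces every index to $k = 0$. *)
Lemma angle_field_shift n gamma alpha eta th k :
  angle_field n gamma alpha eta (th + INR k * PI)
  = angle_field n ((-1) ^ k * gamma) alpha eta th.
Proof.
  revert gamma; induction k as [|k IH]; intros gamma.
  - simpl; rewrite Rmult_0_l, Rplus_0_r, Rmult_1_l; trivial.
  - replace (th + INR (S k) * PI) with (th + INR k * PI + PI)
      by (rewrite S_INR; ring).
    replace ((-1) ^ S k * gamma) with ((-1) ^ k * - gamma) by (simpl; ring).
    rewrite <- IH; unfold angle_field; rewrite neg_sin, neg_cos.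
    set (x := th + INR k * PI).
    replace (alpha * - cos x - eta * - sin x) with (- (alpha * cos x - eta * sin x))
      by ring.
    rewrite reaction_opp; ring.
Qed.

Lemma angle_ode_shift n gamma alpha th k :
  angle_ode n gamma alpha th ->
  angle_ode n ((-1) ^ k * gamma) alpha (fun x => th x - INR k * PI).
Proof.
  intros H eta He; specialize (H eta He).
  rewrite <- angle_field_shift.
  replace (th eta - INR k * PI + INR k * PI) with (th eta) by ring.
  set (l := angle_field _ _ _ _ _) in *.
  auto_derive; [exists l; exact H|]. subst_derive H; ring.
Qed.

Lemma sign_abs k gamma : Rabs ((-1) ^ k * gamma) = Rabs gamma.
Proof. rewrite Rabs_mult, pow_1_abs; ring. Qed.

Lemma sign_range k gamma : -1 < gamma < 1 -> -1 < (-1) ^ k * gamma < 1.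
Proof.
  intros H; pose proof (Rabs_def1 gamma 1 ltac:(lra) ltac:(lra)) as H1.
  rewrite <- (sign_abs k) in H1; apply Rabs_def2 in H1; lra.
Qed.

Lemma damping_sign k gamma : damping ((-1) ^ k * gamma) = damping gamma.
Proof. unfold damping; rewrite sign_abs; trivial. Qed.

Lemma angle_field_tan n gamma alpha eta th t :
  0 < cos th -> sin th = t * cos th ->
  angle_field n gamma alpha eta th
  = cos th ^ 2 * (t ^ 2 - (n - 1) / eta * t - reaction gamma (alpha - eta * t)).
Proof.
  intros Hc Hs; unfold angle_field; rewrite Hs.
  replace (alpha * cos th - eta * (t * cos th)) with (cos th * (alpha - eta * t))
    by ring.
  rewrite reaction_scale by lra; ring.
Qed.

Lemma sin_tan_cos x : 0 < cos x -> sin x = tan x * cos x.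
Proof. intros H; unfold tan; field; lra. Qed.

Lemma cos_sq_tan x : 0 < cos x -> cos x ^ 2 * (1 + tan x ^ 2) = 1.
Proof.
  intros H; pose proof (sin2_cos2 x) as E; unfold Rsqr in E.
  rewrite (sin_tan_cos x H) in E; eapply eq_trans; [|exact E]; ring.
Qed.

(** $\tan\theta = -f'/f$. *)
Lemma tan_riccati n gamma alpha th eta :
  angle_ode n gamma alpha th -> 0 < eta -> 0 < cos (th eta) ->
  is_derive (fun x => tan (th x)) eta
    (tan (th eta) ^ 2 - (n - 1) / eta * tan (th eta)
     - reaction gamma (alpha - eta * tan (th eta))).
Proof.
  intros Ho He Hc. specialize (Ho eta He).
  rewrite (angle_field_tan _ _ _ _ _ _ Hc (sin_tan_cos _ Hc)) in Ho.
  evar_last; [apply (is_derive_comp tan th); [apply is_derive_tan; lra|exact Ho]|].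
  match goal with |- scal ?a ?b = _ => change (scal a b) with (a * b) end.
  set (q := _ - reaction _ _). pose proof (cos_sq_tan _ Hc).
  replace (cos (th eta) ^ 2 * q * (tan (th eta) ^ 2 + 1))
    with (q * (cos (th eta) ^ 2 * (1 + tan (th eta) ^ 2))) by ring.
  rewrite H; ring.
Qed.

(** At the level $k\pi - \pi/2$ the cosine vanishes and the angle equation reads
    $\theta' = 1$. *)
Lemma angle_upcrossing n gamma alpha th k a eta :
  angle_ode n gamma alpha th -> 0 < a < eta ->
  INR k * PI - PI / 2 <= th a -> INR k * PI - PI / 2 < th eta.
Proof.
  intros Ho Ha Hk. apply (angle_ode_shift _ _ _ _ k) in Ho.
  set (g := (-1) ^ k * gamma) in *; set (v := fun x => th x - INR k * PI) in *.
  assert (- v eta - PI / 2 < 0); [|unfold v in *; lra].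
  apply (barrier_strict (fun x => - v x - PI / 2)
           (fun x => - angle_field n g alpha x (v x)) a eta); [lra| | |unfold v; lra].
  - intros x Hx; specialize (Ho x ltac:(lra)). set (l := angle_field _ _ _ _ _) in *.
    auto_derive; [exists l; exact Ho|]. subst_derive Ho; ring.
  - intros x Hx E; replace (v x) with (- (PI / 2)) by lra.
    unfold angle_field; rewrite sin_neg, cos_neg, sin_PI2, cos_PI2; lra.
Qed.

(** On the curve $\tan\theta = C/\eta$, that is $\eta f'/f = -C$, the quantity
    $\alpha + \eta f'/f$ equals $\alpha - C < 0$, and the reaction term, of order
    $\eta^2$, turns the angle back more strongly than the curve bends. *)
Lemma angle_downcrossing n gamma alpha th k C a eta :
  1 <= n -> -1 < gamma < 1 -> 0 <= alpha < C ->
  angle_ode n gamma alpha th -> 0 < a < eta ->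
  C ^ 2 + C < damping gamma * a ^ 2 * (C - alpha) ->
  th a - INR k * PI <= atan (C / a) -> th eta - INR k * PI < atan (C / eta).
Proof.
  intros Hn Hg HC Ho Ha Hb Hk. apply (angle_ode_shift _ _ _ _ k) in Ho.
  rewrite <- (damping_sign k) in Hb; apply (sign_range k) in Hg.
  set (g := (-1) ^ k * gamma) in *; set (v := fun x => th x - INR k * PI) in *.
  pose proof (damping_pos g Hg) as Hm.
  assert (v eta - atan (C / eta) < 0); [|unfold v in *; lra].
  apply (barrier_strict (fun x => v x - atan (C / x))
           (fun x => angle_field n g alpha x (v x) + C / x ^ 2 / (1 + (C / x) ^ 2))
           a eta); [lra| | |unfold v; lra].
  - intros x Hx; specialize (Ho x ltac:(lra)). set (l := angle_field _ _ _ _ _) in *.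
    assert (0 <= (C / x) ^ 2) by apply pow2_ge_0.
    auto_derive; [split; [exists l; exact Ho|split; [lra|trivial]]|].
    subst_derive Ho. unfold Rdiv in *; field.
    assert (0 < x) by lra; assert (0 < x * x) by nra; pose proof (Rle_0_sqr C).
    unfold Rsqr in *; repeat split; simpl; lra.
  - intros x Hx E; assert (Hv : v x = atan (C / x)) by lra.
    pose proof (atan_bound (C / x)) as Hat.
    assert (Hc : 0 < cos (v x)) by (rewrite Hv; apply cos_gt_0; lra).
    assert (Ht : tan (v x) = C / x) by (rewrite Hv; apply tan_atan).
    rewrite (angle_field_tan _ _ _ _ _ _ Hc (sin_tan_cos _ Hc)), Ht.
    pose proof (cos_sq_tan _ Hc) as Hct; rewrite Ht in Hct.
    set (c2 := cos (v x) ^ 2) in *.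
    assert (Hc2 : 0 < c2) by (apply pow_lt; trivial).
    assert (0 <= (C / x) ^ 2) by apply pow2_ge_0.
    replace (C / x ^ 2 / (1 + (C / x) ^ 2)) with (c2 * (C / x ^ 2)).
    2:{ apply Rmult_eq_reg_r with (1 + (C / x) ^ 2); [|lra].
        replace (c2 * (C / x ^ 2) * (1 + (C / x) ^ 2))
          with (C / x ^ 2 * (c2 * (1 + (C / x) ^ 2))) by ring.
        rewrite Hct; field; split; [lra|nra]. }
    rewrite <- Rmult_plus_distr_l.
    destruct (reaction_damping g (alpha - x * (C / x)) Hg) as [mu [Hmu ->]].
    replace (x * (C / x)) with C by (field; lra).
    assert (Hin : (C / x) ^ 2 - (n - 1) / x * (C / x) - - mu * (alpha - C) + C / x ^ 2
                  = (C ^ 2 - (n - 2) * C - mu * x ^ 2 * (C - alpha)) * / x ^ 2)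
      by (field; lra).
    rewrite Hin.
    assert (0 < / x ^ 2) by (apply Rinv_0_lt_compat, pow_lt; lra).
    assert (a ^ 2 <= x ^ 2) by nra.
    assert (damping g * a ^ 2 * (C - alpha) <= mu * x ^ 2 * (C - alpha)).
    { apply Rmult_le_compat_r; [lra|]. assert (0 <= a ^ 2) by nra. nra. }
    assert (0 <= (n - 1) * C) by nra.
    assert (C ^ 2 - (n - 2) * C - mu * x ^ 2 * (C - alpha) < 0) by lra.
    assert (0 < c2 * / x ^ 2) by nra. nra.
Qed.

(** The curve $\eta f'/f = -(\alpha+1)$ separates the slow limit
    $\eta f'/f \to -\alpha$ from the fast one $\eta f'/f \to -\infty$; any constant
    beyond $\alpha$ could replace $\alpha + 1$. *)
Definition tail_slow (alpha : R) (k : nat) (th : R -> R) : Prop :=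
  exists r, 0 < r /\ forall eta, r <= eta ->
    - (PI / 2) < th eta - INR k * PI < atan ((alpha + 1) / eta).

Definition tail_fast (alpha : R) (k : nat) (th : R -> R) : Prop :=
  exists r, 0 < r /\ forall eta, r <= eta ->
    atan ((alpha + 1) / eta) <= th eta - INR k * PI < PI / 2.

Lemma trap_radius gamma alpha C :
  -1 < gamma < 1 -> 0 <= alpha < C ->
  exists r, 0 < r /\ forall a, r <= a -> C ^ 2 + C < damping gamma * a ^ 2 * (C - alpha).
Proof.
  intros Hg HC. pose proof (damping_pos gamma Hg) as Hm.
  set (q := damping gamma * (C - alpha)).
  assert (Hq : 0 < q) by (unfold q; nra).
  set (r := (C ^ 2 + C) / q + 1).
  assert (Hr : 1 <= r).
  { assert (0 <= (C ^ 2 + C) / q) by (apply Rdiv_le_0_compat; nra). unfold r; lra. }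
  exists r; split; [lra|]. intros a Ha.
  replace (damping gamma * a ^ 2 * (C - alpha)) with (q * a ^ 2) by (unfold q; ring).
  assert (r * q = C ^ 2 + C + q) by (unfold r; field; lra).
  assert (r <= a ^ 2) by nra. nra.
Qed.

Lemma half_turns x : 0 <= x ->
  exists k, INR k * PI - PI / 2 <= x < INR k * PI + PI / 2.
Proof.
  intros Hx; pose proof PI_RGT_0 as HPI.
  destruct (nfloor_ex ((x + PI / 2) / PI)) as [k [H1 H2]].
  { apply Rdiv_le_0_compat; lra. }
  exists k.
  assert (E : (x + PI / 2) / PI * PI = x + PI / 2) by (field; lra).
  split; nra.
Qed.

(** Past the radius where the barrier works, follow the angle from the
    half-turn it is in. If it ever drops below the barrier it is caught in a slow
    tail; if it reaches the next zero level it enters the next half-turn below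
    the barrier, and is caught there; otherwise it stays in a fast tail. *)
Lemma tail_dichotomy n gamma alpha th :
  1 <= n -> -1 < gamma < 1 -> 0 < alpha -> shooting_angle n gamma alpha th ->
  exists k, tail_slow alpha k th \/ tail_fast alpha k th.
Proof.
  intros Hn Hg Ha Hs. pose proof (proj1 Hs) as Ho. pose proof PI_RGT_0 as HPI.
  destruct (trap_radius gamma alpha (alpha + 1) Hg ltac:(lra)) as [r [Hr Htrap]].
  destruct (half_turns (th r)) as [k [Hk1 Hk2]].
  { apply (shooting_angle_nonneg n gamma alpha); trivial; lra. }
  assert (Hslow : forall j a, r <= a -> INR j * PI - PI / 2 <= th a ->
            th a - INR j * PI <= atan ((alpha + 1) / a) -> tail_slow alpha j th).
  { intros j a Hra H1 H2. exists (a + 1); split; [lra|]. intros eta He; split.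
    - pose proof (angle_upcrossing n gamma alpha th j a eta Ho ltac:(lra) H1); lra.
    - apply (angle_downcrossing n gamma alpha th j (alpha + 1) a eta); trivial; try lra.
      apply Htrap; trivial. }
  destruct (classic
    (exists b, r <= b /\ INR k * PI + PI / 2 <= th b)) as [[b [Hb1 Hb2]]|Hnup].
  - exists (S k); left.
    destruct (first_hit (fun x => th x - (INR k * PI + PI / 2)) r b) as [c [Hc [Ec _]]];
      try lra.
    { intros x Hx; specialize (Ho x ltac:(lra)). auto_derive. eexists; exact Ho. }
    apply (Hslow (S k) c); rewrite ?S_INR; try lra.
    assert (0 < atan ((alpha + 1) / c)); [|lra].
    rewrite <- atan_0; apply atan_increasing, Rdiv_lt_0_compat; lra.
  - exists k.
    destruct (classic
      (exists b, r <= b /\ th b - INR k * PI < atan ((alpha + 1) / b)))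
      as [[b [Hb1 Hb2]]|Hndown].
    + left; apply (Hslow k b); trivial; [|lra].
      destruct (Req_dec b r) as [->|]; [lra|].
      pose proof (angle_upcrossing n gamma alpha th k r b Ho ltac:(lra) Hk1); lra.
    + right; exists r; split; [trivial|]. intros eta He; split.
      * apply Rnot_lt_le; intros H; apply Hndown; exists eta; lra.
      * apply Rnot_le_lt; intros H; apply Hnup; exists eta; lra.
Qed.

(** The reaction contributes $\alpha$ times a positive constant, up to a term
    linear in $|t|$; completing the square absorbs the linear terms once $\alpha$
    is large. *)
Lemma riccati_lower_bound n gamma alpha eta B kap t :
  1 <= n -> -1 < gamma < 1 -> 0 <= alpha -> 1 <= eta -> n - 1 + eta <= B ->
  (kap ^ 2 + B ^ 2) / 2 <= damping gamma * alpha ->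
  (t ^ 2 + kap ^ 2) / 2
  <= t ^ 2 - (n - 1) / eta * t - reaction gamma (alpha - eta * t).
Proof.
  intros Hn Hg Ha He HB Hk. pose proof (damping_pos gamma Hg) as Hm.
  destruct (reaction_damping gamma (alpha - eta * t) Hg) as [mu [Hmu ->]].
  assert (H1 : damping gamma * alpha - eta * Rabs t <= mu * (alpha - eta * t)).
  { pose proof (Rle_abs t); pose proof (Rabs_pos t).
    destruct (Rle_dec 0 (alpha - eta * t)).
    - apply Rle_trans with (damping gamma * (alpha - eta * t)); [|nra].
      assert (eta * t <= eta * Rabs t) by nra. assert (0 <= eta * Rabs t) by nra. nra.
    - assert (alpha - eta * t <= mu * (alpha - eta * t)) by nra. nra. }
  assert (H2 : (n - 1) / eta * t <= (n - 1) * Rabs t).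
  { assert (0 <= (n - 1) / eta) by (apply Rdiv_le_0_compat; lra).
    assert ((n - 1) / eta <= n - 1).
    { apply Rmult_le_reg_r with eta; [lra|].
      replace ((n - 1) / eta * eta) with (n - 1) by (field; lra). nra. }
    pose proof (Rle_abs t); pose proof (Rabs_pos t). nra. }
  assert (Rabs t ^ 2 = t ^ 2) by apply pow2_abs.
  assert (Rabs t * (n - 1 + eta) <= Rabs t * B)
    by (apply Rmult_le_compat_l; [apply Rabs_pos|lra]).
  pose proof (pow2_ge_0 (Rabs t - B)). lra.
Qed.

(** If the angle did not complete a half-turn on $[a, a+1]$, then $\tan\theta$
    would stay finite, and $\arctan(\tan\theta/\kappa)$ would grow at speed at least
    $\kappa/2 = 2\pi$ on an interval of length 1/2, although its range has length
    $\pi$. *)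
Lemma fast_half_turn n gamma alpha th j a B :
  1 <= n -> -1 < gamma < 1 -> 0 <= alpha -> 1 <= a -> n + a <= B ->
  ((4 * PI) ^ 2 + B ^ 2) / 2 <= damping gamma * alpha ->
  angle_ode n gamma alpha th ->
  INR j * PI - PI / 2 <= th a -> INR (S j) * PI - PI / 2 <= th (a + 1).
Proof.
  intros Hn Hg Ha Ha1 HB Hk Ho Hj.
  destruct (Rle_dec (INR (S j) * PI - PI / 2) (th (a + 1))) as [|Hnot];
    [trivial|exfalso].
  pose proof PI_RGT_0 as HPI.
  set (g := (-1) ^ j * gamma); set (v := fun x => th x - INR j * PI).
  assert (Hv : forall x, a < x <= a + 1 -> - (PI / 2) < v x < PI / 2).
  { intros x Hx; unfold v; split.
    - pose proof (angle_upcrossing _ _ _ _ j a x Ho ltac:(lra) Hj); lra.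
    - rewrite S_INR in Hnot.
      destruct (Rlt_dec (th x - INR j * PI) (PI / 2)) as [|Hx1]; [trivial|exfalso].
      destruct (Req_dec x (a + 1)) as [E|]; [rewrite E in *; lra|].
      pose proof (angle_upcrossing _ _ _ _ (S j) x (a + 1) Ho ltac:(lra)) as Hup.
      rewrite S_INR in Hup; lra. }
  apply (angle_ode_shift _ _ _ _ j) in Ho. fold g in Ho.
  rewrite <- (damping_sign j) in Hk; apply (sign_range j) in Hg; fold g in Hk, Hg.
  set (kap := 4 * PI) in *.
  set (dt := fun x => tan (v x) ^ 2 - (n - 1) / x * tan (v x)
                      - reaction g (alpha - x * tan (v x))).
  set (psi := fun x => atan (tan (v x) / kap)).
  assert (H : psi (a + / 2) - kap / 2 * (a + / 2) <= psi (a + 1) - kap / 2 * (a + 1)).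
  { apply (nonneg_derive_le (fun x => psi x - kap / 2 * x)
      (fun x => kap * (dt x) / (kap ^ 2 + tan (v x) ^ 2) - kap / 2)); [lra| |].
    - intros x Hx; unfold psi.
      pose proof (tan_riccati n g alpha v x Ho ltac:(lra)
                    ltac:(apply cos_gt_0; apply Hv; lra)) as Hd.
      fold (dt x) in Hd.
      assert (Hd1 : is_derive (fun x => atan (tan (v x) / kap)) x
                (dt x * / kap * / (1 + (tan (v x) / kap) ^ 2))).
      { evar_last.
        - apply (is_derive_comp atan (fun x => tan (v x) / kap)).
          + apply is_derive_atan.
          + apply (is_derive_scal_l (fun x => tan (v x)) x (dt x) (/ kap) Hd).
        - match goal with |- scal ?a ?b = _ => change (scal a b) with (a * b) end.
          replace ((tan (v x) / kap) ^ 2) with (tan (v x) / kap)² by (unfold Rsqr; ring).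
          reflexivity. }
      assert (0 < kap ^ 2 + tan (v x) ^ 2).
      { pose proof (pow2_ge_0 (tan (v x))). unfold kap; nra. }
      evar_last; [apply @is_derive_minus; [exact Hd1|]; auto_derive; [trivial|reflexivity]|].
      unfold minus, plus, opp; simpl. field.
      split; unfold kap in *; [simpl in *|]; lra.
    - intros x Hx.
      pose proof (riccati_lower_bound n g alpha x B kap (tan (v x)) Hn Hg Ha
                    ltac:(lra) ltac:(lra) Hk) as Hl. fold (dt x) in Hl.
      assert (0 < kap ^ 2 + tan (v x) ^ 2).
      { pose proof (pow2_ge_0 (tan (v x))). unfold kap; nra. }
      assert (/ 2 <= dt x / (kap ^ 2 + tan (v x) ^ 2)).
      { apply Rmult_le_reg_r with (kap ^ 2 + tan (v x) ^ 2); [trivial|].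
        replace (dt x / (kap ^ 2 + tan (v x) ^ 2) * (kap ^ 2 + tan (v x) ^ 2))
          with (dt x) by (field; lra). lra. }
      unfold Rdiv in *. rewrite Rmult_assoc. unfold kap in *; nra. }
  unfold psi in H.
  pose proof (atan_bound (tan (v (a + / 2)) / kap)).
  pose proof (atan_bound (tan (v (a + 1)) / kap)).
  unfold kap in *; lra.
Qed.

Lemma many_half_turns n gamma k :
  1 <= n -> -1 < gamma < 1 ->
  exists alpha, 0 < alpha /\ forall th, shooting_angle n gamma alpha th ->
    exists eta, 0 < eta /\ INR k * PI + PI / 2 < th eta.
Proof.
  intros Hn Hg. pose proof (damping_pos gamma Hg) as Hm. pose proof PI_RGT_0 as HPI.
  set (B := n + (INR k + 3)).
  set (q := ((4 * PI) ^ 2 + B ^ 2) / 2).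
  assert (Hq : 0 < q) by (unfold q; pose proof (pow2_ge_0 B); nra).
  exists (q / damping gamma); split; [apply Rdiv_lt_0_compat; trivial|].
  intros th Hs; set (alpha := q / damping gamma) in *.
  assert (Ha : 0 < alpha) by (apply Rdiv_lt_0_compat; trivial).
  assert (Hqa : q <= damping gamma * alpha).
  { apply Req_le; unfold alpha; field; lra. }
  assert (Hind : forall j, (j <= k + 1)%nat -> INR j * PI - PI / 2 <= th (INR j + 1)).
  { induction j as [|j IH]; intros Hj.
    - pose proof (shooting_angle_nonneg n gamma alpha th Hn Hg ltac:(lra) Hs (INR 0 + 1)).
      simpl in *; lra.
    - rewrite (S_INR j) at 2. pose proof (pos_INR j).
      apply (fast_half_turn n gamma alpha th j (INR j + 1) B); trivial; try lra.
      + apply le_INR in Hj; rewrite S_INR, plus_INR in Hj; simpl in Hj. unfold B; lra.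
      + apply Hs.
      + apply IH; lia. }
  specialize (Hind (k + 1)%nat (le_n _)). rewrite plus_INR in Hind; simpl INR in Hind.
  pose proof (pos_INR k).
  exists (INR k + 3); split; [lra|].
  pose proof (angle_upcrossing n gamma alpha th (S k) (INR k + 1 + 1) (INR k + 3)
                (proj1 Hs) ltac:(lra)) as Hup.
  rewrite S_INR in Hup. lra.
Qed.

(** * Convergence rates in the two tails *)

(** For $y = \alpha + \eta f'/f = \alpha - \eta t$ the Riccati equation becomes
    $y' = (n-2)t - \eta t^2 - \mu\eta y$ with $\mu$ bounded below. The first two
    terms are $O(1/\eta)$: from above by completing the square, and, where
    $y < 0$, from below because the barrier bounds $\eta t$. The damping $\mu\eta$
    then forces $y = O(\eta^{-2})$. *)
Lemma slow_rate n gamma alpha v r :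
  1 <= n -> -1 < gamma < 1 -> 0 < alpha -> angle_ode n gamma alpha v -> 0 < r ->
  (forall eta, r <= eta -> - (PI / 2) < v eta < atan ((alpha + 1) / eta)) ->
  exists K r1, r <= r1 /\ forall eta, r1 <= eta ->
    Rabs (alpha - eta * tan (v eta)) <= K / eta ^ 2.
Proof.
  intros Hn Hg Ha Ho Hr Hv. pose proof (damping_pos gamma Hg) as Hm.
  set (m := damping gamma) in *.
  set (t := fun x => tan (v x)).
  set (y := fun x => alpha - x * t x).
  assert (Hcos : forall x, r <= x -> 0 < cos (v x)).
  { intros x Hx; specialize (Hv x Hx); pose proof (atan_bound ((alpha + 1) / x)).
    apply cos_gt_0; lra. }
  assert (Hy1 : forall x, r <= x -> -1 < y x).
  { intros x Hx; specialize (Hv x Hx); pose proof (atan_bound ((alpha + 1) / x)).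
    assert (t x < (alpha + 1) / x).
    { rewrite <- tan_atan; apply tan_increasing; lra. }
    assert (x * t x < x * ((alpha + 1) / x)) by (apply Rmult_lt_compat_l; lra).
    replace (x * ((alpha + 1) / x)) with (alpha + 1) in * by (field; lra).
    unfold y; lra. }
  set (dy := fun x => (n - 2) * t x - x * t x ^ 2 + x * reaction gamma (y x)).
  assert (Hdy : forall x, r <= x -> is_derive y x (dy x)).
  { intros x Hx.
    pose proof (tan_riccati n gamma alpha v x Ho ltac:(lra) (Hcos x Hx)) as Hd.
    change (fun x => tan (v x)) with t in Hd; fold (t x) in Hd; fold (y x) in Hd.
    unfold y. set (l := _ - _ - _) in Hd.
    auto_derive; [exists l; exact Hd|]. subst_derive Hd. unfold l, dy, y; field; lra. }
  set (c1 := (n - 2) ^ 2 / 4 + (alpha + 1) + (alpha + 1) ^ 2).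
  set (c0 := 2 * c1 / m).
  assert (Hc1 : 0 < c1) by (unfold c1; pose proof (pow2_ge_0 (n - 2)); nra).
  assert (Hc0 : m * c0 = 2 * c1) by (unfold c0; field; lra).
  assert (Hc0p : 0 < c0) by (unfold c0; apply Rdiv_lt_0_compat; lra).
  set (r1 := Rmax r (4 / m + 1)).
  assert (Hr1 : r <= r1 /\ 4 / m + 1 <= r1) by (split; [apply Rmax_l|apply Rmax_r]).
  assert (H4m : 0 < 4 / m) by (apply Rdiv_lt_0_compat; lra).
  assert (Hbig : forall x, r1 <= x -> 1 <= x /\ 4 <= m * x ^ 2).
  { intros x Hx; split; [lra|]. assert (4 / m * m = 4) by (field; lra).
    assert (x <= x ^ 2) by nra. nra. }
  (* the same estimate closes both sides *)
  assert (Hclose : forall x u Y, r1 <= x -> u = Y - c0 / x ^ 2 -> 0 < u ->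
            forall dY, dY <= c1 / x - x * m * Y -> dY + 2 * c0 / x ^ 3 <= - (2 * u / x)).
  { intros x u Y Hx Hu Hup dY HdY. destruct (Hbig x Hx) as [Hx1 Hx2].
    assert (HY : Y = u + c0 / x ^ 2) by lra.
    assert (H1 : x * m * Y = m * x * u + m * c0 / x) by (rewrite HY; field; lra).
    assert (Hix : 0 < / x) by (apply Rinv_0_lt_compat; lra).
    assert (H2 : 2 * c0 / x ^ 3 <= c1 / x).
    { apply Rmult_le_reg_r with (x ^ 3); [apply pow_lt; lra|].
      replace (2 * c0 / x ^ 3 * x ^ 3) with (2 * c0) by (field; lra).
      replace (c1 / x * x ^ 3) with (c1 * x ^ 2) by (field; lra). nra. }
    assert (H3 : 2 * u / x <= m * x * u).
    { apply Rmult_le_reg_r with x; [lra|].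
      replace (2 * u / x * x) with (2 * u) by (field; lra). nra. }
    rewrite H1, Hc0 in HdY. unfold Rdiv in *. lra. }
  assert (Hsq : forall x, r1 <= x -> is_derive (fun x => c0 / x ^ 2) x (- (2 * c0 / x ^ 3))).
  { intros x Hx. destruct (Hbig x Hx). auto_derive; [nra|field; lra]. }
  destruct (stable_decay (fun x => y x - c0 / x ^ 2) (fun x => dy x + 2 * c0 / x ^ 3) r1)
    as [K1 [HK1 HK1']]; [lra| | |].
  { intros x Hx. evar_last; [apply @is_derive_minus; [apply Hdy; lra|apply Hsq, Hx]|].
    unfold minus, plus, opp; simpl; ring. }
  { intros x Hx Hp. apply (Hclose x _ (y x)); trivial.
    destruct (Hbig x Hx) as [Hx1 Hx2].
    assert (Hyp : 0 < y x).
    { assert (0 < c0 / x ^ 2) by (apply Rdiv_lt_0_compat; [lra|apply pow_lt; lra]). lra. }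
    destruct (reaction_damping gamma (y x) Hg) as [mu [Hmu E]]. fold m in Hmu.
    unfold dy; rewrite E.
    assert (H1 : (n - 2) * t x - x * t x ^ 2 <= (n - 2) ^ 2 / 4 / x).
    { apply Rmult_le_reg_r with x; [lra|].
      replace ((n - 2) ^ 2 / 4 / x * x) with ((n - 2) ^ 2 / 4) by (field; lra).
      pose proof (pow2_ge_0 ((n - 2) / 2 - x * t x)). lra. }
    assert (H2 : (n - 2) ^ 2 / 4 / x <= c1 / x).
    { apply Rmult_le_compat_r; [apply Rlt_le, Rinv_0_lt_compat; lra|unfold c1; nra]. }
    assert (x * m * y x <= x * mu * y x) by (apply Rmult_le_compat_r; nra).
    lra. }
  destruct (stable_decay (fun x => - y x - c0 / x ^ 2) (fun x => - dy x + 2 * c0 / x ^ 3) r1)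
    as [K2 [HK2 HK2']]; [lra| | |].
  { intros x Hx. evar_last; [apply @is_derive_minus; [apply @is_derive_opp, Hdy; lra
      |apply Hsq, Hx]|].
    unfold minus, plus, opp; simpl; ring. }
  { intros x Hx Hp. apply (Hclose x _ (- y x)); trivial.
    destruct (Hbig x Hx) as [Hx1 Hx2].
    assert (Hyp : y x < 0).
    { assert (0 < c0 / x ^ 2) by (apply Rdiv_lt_0_compat; [lra|apply pow_lt; lra]). lra. }
    specialize (Hy1 x ltac:(lra)).
    destruct (reaction_damping gamma (y x) Hg) as [mu [Hmu E]]. fold m in Hmu.
    unfold dy; rewrite E.
    set (w := x * t x). assert (Hw : 0 < w < alpha + 1) by (unfold y in *; fold w in Hy1, Hyp; lra).
    assert (H1 : - ((n - 2) * t x - x * t x ^ 2) <= c1 / x).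
    { apply Rmult_le_reg_r with x; [lra|].
      replace (c1 / x * x) with c1 by (field; lra).
      replace (- ((n - 2) * t x - x * t x ^ 2) * x) with (- (n - 2) * w + w ^ 2)
        by (unfold w; ring).
      assert (- (n - 2) * w <= w) by nra. assert (w ^ 2 <= (alpha + 1) ^ 2) by nra.
      pose proof (pow2_ge_0 (n - 2)). unfold c1; lra. }
    assert (x * m * - y x <= x * mu * - y x) by (apply Rmult_le_compat_r; nra).
    lra. }
  exists (c0 + K1 + K2), r1; split; [lra|]. intros x Hx.
  specialize (HK1' x Hx); specialize (HK2' x Hx). destruct (Hbig x Hx) as [Hx1 Hx2].
  change (alpha - x * tan (v x)) with (y x).
  assert (0 < / x ^ 2) by (apply Rinv_0_lt_compat, pow_lt; lra).
  unfold Rdiv in *. apply Rabs_le; split; nra.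
Qed.

(** Below the barrier $\alpha f + \eta f'$ has the sign opposite to $f$, so a
    single value of $\sigma$ is active and the equation for $1/t = -f/f'$ is an
    explicit Riccati equation. Passing to the reciprocal turns a possible blow-up
    of $f'/f$ into an a priori bound, linear in $\eta$. *)
Lemma fast_recip n gamma alpha v r :
  -1 < gamma < 1 -> 0 < alpha -> angle_ode n gamma alpha v -> 0 < r ->
  (forall eta, r <= eta -> atan ((alpha + 1) / eta) <= v eta < PI / 2) ->
  forall eta, r <= eta ->
    0 < tan (v eta) /\ 0 < / tan (v eta) <= eta / (alpha + 1) /\
    is_derive (fun x => / tan (v x)) eta
      (- 1 + ((n - 1) / eta + (1 + gamma) / 2 * eta) * / tan (v eta)
       - (1 + gamma) / 2 * alpha * (/ tan (v eta)) ^ 2).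
Proof.
  intros Hg Ha Ho Hr Hv x Hx. specialize (Hv x Hx).
  pose proof (atan_bound ((alpha + 1) / x)).
  assert (Hq : 0 < (alpha + 1) / x) by (apply Rdiv_lt_0_compat; lra).
  assert (Hc : 0 < cos (v x)).
  { assert (0 < atan ((alpha + 1) / x)) by (rewrite <- atan_0; apply atan_increasing, Hq).
    apply cos_gt_0; lra. }
  assert (Ht : (alpha + 1) / x <= tan (v x)).
  { rewrite <- (tan_atan ((alpha + 1) / x)).
    destruct (Req_dec (atan ((alpha + 1) / x)) (v x)) as [->|]; [lra|].
    apply Rlt_le, tan_increasing; lra. }
  pose proof (tan_riccati n gamma alpha v x Ho ltac:(lra) Hc) as Hd.
  set (t := tan (v x)) in *.
  assert (Hxt : alpha + 1 <= x * t).
  { replace (alpha + 1) with (x * ((alpha + 1) / x)) by (field; lra).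
    apply Rmult_le_compat_l; lra. }
  assert (E : reaction gamma (alpha - x * t) = - ((1 + gamma) / 2) * (alpha - x * t)).
  { rewrite reactionE, Rabs_left by lra; field. }
  rewrite E in Hd. set (l := _ - _ - _) in Hd.
  split; [lra|split; [split|]].
  - apply Rinv_0_lt_compat; lra.
  - replace (x / (alpha + 1)) with (/ ((alpha + 1) / x)) by (field; lra).
    apply Rinv_le_contravar; lra.
  - set (tf := fun z => tan (v z)); change (is_derive tf x l) in Hd.
    assert (Etf : tf x = t) by reflexivity.
    change (is_derive (fun z => / tf z) x
      (- 1 + ((n - 1) / x + (1 + gamma) / 2 * x) * / t
       - (1 + gamma) / 2 * alpha * (/ t) ^ 2)).
    auto_derive; [split; [exists l; exact Hd|split; [lra|trivial]]|].
    subst_derive Hd. rewrite Etf; unfold l; field; lra.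
Qed.

(** An unstable linear equation has a single slowly growing solution, which is
    of the size of the forcing divided by the rate; subtracting the expected bound
    gives a quantity to which [unstable_nonpos] applies. *)
Lemma unstable_small (E A b : R -> R) (r c C K : R) (j : nat) :
  0 < r -> 0 < c -> 0 <= K -> 3 <= c * r ^ 2 ->
  (forall x, r <= x -> is_derive E x (A x * E x + b x)) ->
  (forall x, r <= x -> c * x <= A x) ->
  (forall x, r <= x -> - (c * K / x ^ j) <= b x) ->
  (forall x, r <= x -> E x <= C * x ^ 2) ->
  forall x, r <= x -> E x <= K / x ^ S j.
Proof.
  intros Hr Hc HK Hcr Hd HA Hb HC x Hx.
  assert (E x - K / x ^ S j <= 0); [|lra].
  revert x Hx.
  apply (unstable_nonpos (fun x => E x - K / x ^ S j)
          (fun x => A x * E x + b x + K * INR (S j) / x ^ S (S j)) r C Hr).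
  - intros x Hx; specialize (Hd x Hx). set (l := _ + _) in Hd.
    assert (Hj : 0 < x ^ j) by (apply pow_lt; lra).
    auto_derive; [split; [exists l; exact Hd|split; [|trivial]]|].
    + change (x * x ^ j <> 0); nra.
    + subst_derive Hd. change (Nat.pred (S j)) with j.
      change (x ^ S (S j)) with (x * (x * x ^ j)). change (x ^ S j) with (x * x ^ j).
      change (match j with | 0%nat => 1 | S _ => INR j + 1 end) with (INR (S j)).
      fold l. field; lra.
  - intros x Hx Hp.
    assert (Hj : 0 < x ^ j) by (apply pow_lt; lra).
    assert (HKj : 0 <= K / x ^ S j) by (apply Rdiv_le_0_compat; [lra|apply pow_lt; lra]).
    assert (0 <= K * INR (S j) / x ^ S (S j)).
    { apply Rdiv_le_0_compat; [|apply pow_lt; lra].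
      apply Rmult_le_pos; [lra|apply pos_INR]. }
    specialize (HA x Hx); specialize (Hb x Hx).
    set (D := E x - K / x ^ S j) in *.
    assert (HAE : c * x * E x <= A x * E x) by (apply Rmult_le_compat_r; unfold D in *; lra).
    assert (Hsplit : c * x * E x = c * x * D + c * K / x ^ j).
    { unfold D. change (x ^ S j) with (x * x ^ j). field; lra. }
    assert (3 * D / x <= c * x * D); [|lra].
    apply Rmult_le_reg_r with x; [lra|].
    replace (3 * D / x * x) with (3 * D) by (field; lra).
    assert (c * r ^ 2 <= c * x ^ 2) by (apply Rmult_le_compat_l; nra). nra.
  - intros x Hx; specialize (HC x Hx).
    assert (0 <= K / x ^ S j) by (apply Rdiv_le_0_compat; [lra|apply pow_lt; lra]). lra.
Qed.

Lemma unstable_small_abs (E A b : R -> R) (r c C K : R) (j : nat) :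
  0 < r -> 0 < c -> 0 <= K -> 3 <= c * r ^ 2 ->
  (forall x, r <= x -> is_derive E x (A x * E x + b x)) ->
  (forall x, r <= x -> c * x <= A x) ->
  (forall x, r <= x -> Rabs (b x) <= c * K / x ^ j) ->
  (forall x, r <= x -> Rabs (E x) <= C * x ^ 2) ->
  forall x, r <= x -> Rabs (E x) <= K / x ^ S j.
Proof.
  intros Hr Hc HK Hcr Hd HA Hb HC x Hx. apply Rabs_le; split.
  - assert (- E x <= K / x ^ S j); [|lra]. revert x Hx.
    apply (unstable_small (fun x => - E x) A (fun x => - b x) r c C K j); trivial.
    + intros x Hx. evar_last; [apply @is_derive_opp, Hd, Hx|].
      unfold opp; simpl; ring.
    + intros x Hx; specialize (Hb x Hx); apply Rabs_le_between in Hb; lra.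
    + intros x Hx; specialize (HC x Hx); apply Rabs_le_between in HC; lra.
  - revert x Hx.
    apply (unstable_small E A b r c C K j); trivial.
    + intros x Hx; specialize (Hb x Hx); apply Rabs_le_between in Hb; lra.
    + intros x Hx; specialize (HC x Hx); apply Rabs_le_between in HC; lra.
Qed.

(** With $q = 1/\tan v = -f/f'$, $c = (1+\gamma)/2$, $a = \alpha - n$, the
    expected expansion of $1/q$ is $Q = c\eta - a/\eta$. The defect $E = 1 - qQ$ satisfies
    exactly
    $E' = A E + a(\alpha-2)q/\eta^2$,
    $A = (n-1)/\eta + c\eta - c\alpha q - (\alpha-1)/\eta$,
    and $A$ is bounded below by a multiple of $\eta$. Applying instability twice
    improves $E$ from $O(\eta^2)$ to $O(\eta^{-2})$ and then to $O(\eta^{-4})$. *)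
Lemma fast_rate n gamma alpha v r :
  1 <= n -> -1 < gamma < 1 -> 0 < alpha -> angle_ode n gamma alpha v -> 0 < r ->
  (forall eta, r <= eta -> atan ((alpha + 1) / eta) <= v eta < PI / 2) ->
  exists K r1, r <= r1 /\ 0 < K /\ forall eta, r1 <= eta ->
    / tan (v eta) <= K / eta /\
    Rabs (tan (v eta) - ((1 + gamma) / 2 * eta - (alpha - n) / eta)) <= K / eta ^ 2.
Proof.
  intros Hn Hg Ha Ho Hr Hv.
  pose proof (fast_recip n gamma alpha v r Hg Ha Ho Hr Hv) as HF.
  set (c := (1 + gamma) / 2) in *. assert (Hc : 0 < c < 1) by (unfold c; lra).
  set (a := alpha - n) in *.
  set (q := fun x => / tan (v x)) in *.
  set (Q := fun x => c * x - a / x).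
  set (E := fun x => 1 - q x * Q x).
  set (A := fun x => (n - 1) / x + c * x - c * alpha * q x - (alpha - 1) / x).
  set (b := fun x => a * (alpha - 2) * q x / x ^ 2).
  assert (HdE : forall x, r <= x -> is_derive E x (A x * E x + b x)).
  { intros x Hx; destruct (HF x Hx) as [_ [_ Hd]]. change (/ tan (v x)) with (q x) in Hd.
    set (l := _ - _) in Hd. unfold E, Q.
    auto_derive; [split; [exists l; exact Hd|split; [lra|trivial]]|].
    subst_derive Hd. unfold l, A, b, E, Q, a; field; lra. }
  set (c0 := c / (2 * (alpha + 1))).
  assert (Hc0 : 0 < c0) by (apply Rdiv_lt_0_compat; lra).
  assert (Hc0c : c0 * (alpha + 1) = c / 2) by (unfold c0; field; lra).
  pose proof (Rabs_pos a) as Habs.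
  set (r0 := Rmax (Rmax r 1) (Rmax ((Rabs a + 3) / c0) (2 * Rabs a / c + 1))).
  assert (Hr0 : r <= r0 /\ 1 <= r0 /\ (Rabs a + 3) / c0 <= r0 /\ 2 * Rabs a / c <= r0).
  { unfold r0.
    pose proof (Rmax_l (Rmax r 1) (Rmax ((Rabs a + 3) / c0) (2 * Rabs a / c + 1))).
    pose proof (Rmax_r (Rmax r 1) (Rmax ((Rabs a + 3) / c0) (2 * Rabs a / c + 1))).
    pose proof (Rmax_l r 1); pose proof (Rmax_r r 1).
    pose proof (Rmax_l ((Rabs a + 3) / c0) (2 * Rabs a / c + 1)).
    pose proof (Rmax_r ((Rabs a + 3) / c0) (2 * Rabs a / c + 1)). lra. }
  assert (Hbig : forall x, r0 <= x -> Rabs a + 3 <= c0 * x ^ 2 /\ 2 * Rabs a <= c * x ^ 2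
                    /\ x <= x ^ 2).
  { intros x Hx.
    assert ((Rabs a + 3) / c0 * c0 = Rabs a + 3) by (field; lra).
    assert (2 * Rabs a / c * c = 2 * Rabs a) by (field; lra).
    assert (x <= x ^ 2) by nra. repeat split; nra. }
  assert (Haa : - Rabs a <= a <= Rabs a) by (apply Rabs_le_between; lra).
  assert (Hq : forall x, r0 <= x -> 0 < q x /\ q x * (alpha + 1) <= x).
  { intros x Hx; destruct (HF x ltac:(lra)) as [_ [[H1 H2] _]].
    split; [exact H1|]. change (/ tan (v x)) with (q x) in H2.
    replace x with (x / (alpha + 1) * (alpha + 1)) at 2 by (field; lra).
    apply Rmult_le_compat_r; lra. }
  assert (HA : forall x, r0 <= x -> c0 * x <= A x).
  { intros x Hx; destruct (Hq x Hx) as [Hq0 Hq1]; destruct (Hbig x Hx) as [Hb1 [Hb2 Hb3]].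
    apply Rmult_le_reg_r with x; [lra|].
    replace (A x * x) with (c * x ^ 2 - c * alpha * (q x * x) - a)
      by (unfold A, a; field; lra).
    assert (Hqx : c * alpha * (q x * x) * (alpha + 1) <= c * alpha * x ^ 2).
    { replace (c * alpha * (q x * x) * (alpha + 1))
        with (c * alpha * x * (q x * (alpha + 1))) by ring.
      replace (c * alpha * x ^ 2) with (c * alpha * x * x) by ring.
      apply Rmult_le_compat_l; [|lra].
      assert (0 < c * alpha) by nra. nra. }
    assert (H1 : 2 * c0 * x ^ 2 <= c * x ^ 2 - c * alpha * (q x * x)).
    { apply Rmult_le_reg_r with (alpha + 1); [lra|].
      replace (2 * c0 * x ^ 2 * (alpha + 1)) with (2 * x ^ 2 * (c0 * (alpha + 1))) by ring.
      rewrite Hc0c. lra. }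
    lra. }
  assert (HQ : forall x, r0 <= x -> c / 2 * x <= Q x <= 3 / 2 * c * x).
  { intros x Hx; destruct (Hbig x Hx) as [Hb1 [Hb2 Hb3]]. unfold Q.
    assert (- (c / 2 * x) <= a / x <= c / 2 * x); [|lra].
    split; apply Rmult_le_reg_r with x; try lra;
      replace (a / x * x) with a by (field; lra); nra. }
  assert (HEC : forall x, r0 <= x -> Rabs (E x) <= 3 * x ^ 2).
  { intros x Hx; destruct (Hq x Hx) as [Hq0 Hq1]; specialize (HQ x Hx).
    destruct (Hbig x Hx) as [Hb1 [Hb2 Hb3]].
    assert (q x <= x) by nra.
    assert (0 <= q x * Q x) by (apply Rmult_le_pos; nra).
    assert (q x * Q x <= x * (3 / 2 * x)) by (apply Rmult_le_compat; nra).
    unfold E; apply Rabs_le; split; nra. }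
  set (B := Rabs (a * (alpha - 2))).
  assert (HB : 0 <= B) by apply Rabs_pos.
  assert (Hb0 : forall x, 0 < x -> 0 < q x -> Rabs (b x) = B * q x / x ^ 2).
  { intros x Hx Hqx; unfold b, Rdiv. assert (0 < / x ^ 2) by (apply Rinv_0_lt_compat, pow_lt; lra).
    rewrite !(Rabs_mult (_ * _)), (Rabs_pos_eq (q x)), (Rabs_pos_eq (/ _)) by lra.
    reflexivity. }
  assert (H3r : 3 <= c0 * r0 ^ 2) by (destruct (Hbig r0 (Rle_refl _)); lra).
  (* first pass: the crude bound on q makes the forcing O(1/x) *)
  set (K1 := B / c0).
  assert (HK1 : 0 <= K1) by (apply Rdiv_le_0_compat; lra).
  assert (HE1 : forall x, r0 <= x -> Rabs (E x) <= K1 / x ^ 2).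
  { apply (unstable_small_abs E A b r0 c0 3 K1 1); trivial; [lra| |].
    - intros x Hx; apply HdE; lra.
    - intros x Hx; destruct (Hq x Hx) as [Hq0 Hq1].
      rewrite Hb0 by lra. replace (c0 * K1) with B by (unfold K1; field; lra).
      apply Rmult_le_reg_r with (x ^ 2); [apply pow_lt; lra|].
      replace (B * q x / x ^ 2 * x ^ 2) with (B * q x) by (field; lra).
      replace (B / x ^ 1 * x ^ 2) with (B * x) by (field; lra).
      apply Rmult_le_compat_l; nra. }
  set (r1 := Rmax r0 (2 * K1 + 1)).
  assert (Hr1 : r0 <= r1 /\ 2 * K1 <= r1).
  { pose proof (Rmax_l r0 (2 * K1 + 1)); pose proof (Rmax_r r0 (2 * K1 + 1)).
    unfold r1; lra. }
  assert (HEh : forall x, r1 <= x -> Rabs (E x) <= / 2).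
  { intros x Hx; eapply Rle_trans; [apply HE1; lra|].
    destruct (Hbig x ltac:(lra)) as [_ [_ Hb3]].
    apply Rmult_le_reg_r with (x ^ 2); [nra|].
    replace (K1 / x ^ 2 * x ^ 2) with K1 by (field; lra). lra. }
  assert (Hq1 : forall x, r1 <= x -> q x <= 3 / c / x).
  { intros x Hx; specialize (HEh x Hx); apply Rabs_le_between in HEh.
    specialize (HQ x ltac:(lra)); destruct (Hq x ltac:(lra)) as [Hq0 _].
    apply Rmult_le_reg_r with (c / 2 * x); [nra|].
    replace (3 / c / x * (c / 2 * x)) with (3 / 2) by (field; lra).
    apply Rle_trans with (q x * Q x); [apply Rmult_le_compat_l; lra|].
    unfold E in HEh; lra. }
  (* second pass: now q = O(1/x), so the forcing is O(1/x^3) *)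
  set (K2 := B * (3 / c) / c0).
  assert (HK2 : 0 <= K2).
  { apply Rdiv_le_0_compat; [|lra]. apply Rmult_le_pos; [lra|].
    apply Rdiv_le_0_compat; lra. }
  assert (HE2 : forall x, r1 <= x -> Rabs (E x) <= K2 / x ^ 4).
  { apply (unstable_small_abs E A b r1 c0 3 K2 3); trivial; try lra.
    - assert (c0 * r0 ^ 2 <= c0 * r1 ^ 2) by (apply Rmult_le_compat_l; nra). lra.
    - intros x Hx; apply HdE; lra.
    - intros x Hx; apply HA; lra.
    - intros x Hx; destruct (Hq x ltac:(lra)) as [Hq0 _]. specialize (Hq1 x Hx).
      rewrite Hb0 by lra. replace (c0 * K2) with (B * (3 / c)) by (unfold K2; field; lra).
      replace (B * (3 / c) / x ^ 3) with (B * (3 / c / x) / x ^ 2) by (field; lra).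
      unfold Rdiv at 1 2. apply Rmult_le_compat_r.
      + apply Rlt_le, Rinv_0_lt_compat, pow_lt; lra.
      + apply Rmult_le_compat_l; lra.
    - intros x Hx; apply HEC; lra. }
  exists (3 / c + 3 * K2), r1; split; [lra|].
  assert (H3c : 0 < 3 / c) by (apply Rdiv_lt_0_compat; lra).
  split; [lra|]. intros x Hx.
  destruct (HF x ltac:(lra)) as [Ht _]. fold (Q x).
  change (/ tan (v x)) with (q x).
  specialize (Hq1 x Hx); destruct (Hq x ltac:(lra)) as [Hq0 _].
  split.
  { eapply Rle_trans; [exact Hq1|]. unfold Rdiv at 1 3; apply Rmult_le_compat_r; [|lra].
    apply Rlt_le, Rinv_0_lt_compat; lra. }
  specialize (HEh x Hx); specialize (HE2 x Hx); specialize (HQ x ltac:(lra)).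
  (* t = Q / (1 - E) is at most 2 Q *)
  assert (Htq : tan (v x) * q x = 1) by (unfold q; field; lra).
  assert (HtE : tan (v x) - Q x = tan (v x) * E x).
  { unfold E; rewrite Rmult_minus_distr_l, <- Rmult_assoc, Htq; ring. }
  rewrite HtE, Rabs_mult, (Rabs_pos_eq (tan (v x))) by lra.
  assert (Ht3 : tan (v x) <= 3 * x).
  { apply Rabs_le_between in HEh.
    assert (tan (v x) * (1 - E x) = Q x).
    { unfold E; replace (1 - (1 - q x * Q x)) with (q x * Q x) by ring.
      rewrite <- Rmult_assoc, Htq; ring. }
    assert (tan (v x) * / 2 <= tan (v x) * (1 - E x)) by (apply Rmult_le_compat_l; lra).
    nra. }
  assert (H4 : 0 <= K2 / x ^ 4) by (apply Rdiv_le_0_compat; [lra|apply pow_lt; lra]).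
  apply Rle_trans with (3 * x * (K2 / x ^ 4)).
  { apply Rmult_le_compat; try lra. apply Rabs_pos. }
  apply Rmult_le_reg_r with (x ^ 3); [apply pow_lt; lra|].
  replace (3 * x * (K2 / x ^ 4) * x ^ 3) with (3 * K2) by (field; lra).
  replace ((3 / c + 3 * K2) / x ^ 2 * x ^ 3) with ((3 / c + 3 * K2) * x) by (field; lra).
  nra.
Qed.

(** The difference $D$ of the two values of $-f/f'$ is nonnegative by
    comparison of the angles, and nonpositive by instability, since
    $D' = (c\eta + O(1/\eta)) D$ plus the positive term $c(\beta-\alpha)q^2$; but
    this same term forbids $D$ to vanish identically. *)
Lemma fast_unique n gamma alpha beta v w r :
  1 <= n -> -1 < gamma < 1 -> 0 < alpha < beta -> 0 < r ->
  angle_ode n gamma alpha v -> angle_ode n gamma beta w ->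
  (forall eta, r <= eta -> atan ((alpha + 1) / eta) <= v eta < PI / 2) ->
  (forall eta, r <= eta -> atan ((beta + 1) / eta) <= w eta < PI / 2) ->
  (forall eta, r <= eta -> v eta <= w eta) -> False.
Proof.
  intros Hn Hg Hab Hr Hov How Hv Hw Hvw.
  destruct (fast_rate n gamma alpha v r) as [K1 [r1 [Hr1 [HK1 HR1]]]]; trivial; [lra|].
  destruct (fast_rate n gamma beta w r) as [K2 [r2 [Hr2 [HK2 HR2]]]]; trivial; [lra|].
  pose proof (fast_recip n gamma alpha v r Hg ltac:(lra) Hov Hr Hv) as HFv.
  pose proof (fast_recip n gamma beta w r Hg ltac:(lra) How Hr Hw) as HFw.
  set (c := (1 + gamma) / 2) in *. assert (Hc : 0 < c < 1) by (unfold c; lra).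
  set (p := fun x => / tan (v x)) in *. set (q := fun x => / tan (w x)) in *.
  set (G := (3 + c * alpha * (K1 + K2)) / c).
  assert (HG : 0 < G).
  { apply Rdiv_lt_0_compat; [|lra]. assert (0 < c * alpha) by nra. nra. }
  set (s := Rmax (Rmax r1 r2) (G + 1)).
  assert (Hs : r1 <= s /\ r2 <= s /\ G + 1 <= s).
  { unfold s. pose proof (Rmax_l (Rmax r1 r2) (G + 1)).
    pose proof (Rmax_r (Rmax r1 r2) (G + 1)).
    pose proof (Rmax_l r1 r2); pose proof (Rmax_r r1 r2). lra. }
  set (D := fun x => p x - q x).
  set (dD := fun x => ((n - 1) / x + c * x - c * alpha * (p x + q x)) * D x
                      + c * (beta - alpha) * q x ^ 2).
  assert (Hd : forall x, s <= x -> is_derive D x (dD x)).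
  { intros x Hx. destruct (HFv x ltac:(lra)) as [_ [_ H1]].
    destruct (HFw x ltac:(lra)) as [_ [_ H2]].
    evar_last; [apply @is_derive_minus; [exact H1|exact H2]|].
    change (/ tan (v x)) with (p x). change (/ tan (w x)) with (q x).
    unfold minus, plus, opp; simpl. unfold dD, D; field; lra. }
  assert (Hq : forall x, s <= x -> 0 < q x).
  { intros x Hx; destruct (HFw x ltac:(lra)) as [_ [[H _] _]]; exact H. }
  assert (HD0 : forall x, s <= x -> 0 <= D x).
  { intros x Hx. destruct (HFv x ltac:(lra)) as [Hvp _].
    specialize (Hv x ltac:(lra)); specialize (Hw x ltac:(lra)); specialize (Hvw x ltac:(lra)).
    pose proof (atan_bound ((alpha + 1) / x)).
    assert (tan (v x) <= tan (w x)).
    { destruct (Req_dec (v x) (w x)) as [->|]; [lra|].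
      apply Rlt_le, tan_increasing; lra. }
    assert (q x <= p x) by (apply Rinv_le_contravar; lra). unfold D; lra. }
  assert (Hle : forall x, s <= x -> D x <= 0).
  { apply (unstable_nonpos D dD s K1); [lra|exact Hd| |].
    - intros x Hx Hp. unfold dD.
      pose proof (pow2_ge_0 (q x)).
      assert (0 <= c * (beta - alpha) * q x ^ 2).
      { apply Rmult_le_pos; [|lra]. apply Rmult_le_pos; lra. }
      assert (3 / x <= (n - 1) / x + c * x - c * alpha * (p x + q x)).
      { destruct (HR1 x ltac:(lra)) as [H1 _]. destruct (HR2 x ltac:(lra)) as [H2 _].
        change (/ tan (v x)) with (p x) in H1. change (/ tan (w x)) with (q x) in H2.
        assert (0 <= (n - 1) / x) by (apply Rdiv_le_0_compat; lra).
        assert (c * alpha * (p x + q x) <= c * alpha * ((K1 + K2) / x)).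
        { apply Rmult_le_compat_l; [nra|]. unfold Rdiv in *; lra. }
        assert (3 / x + c * alpha * ((K1 + K2) / x) <= c * x); [|lra].
        apply Rmult_le_reg_r with x; [lra|].
        replace ((3 / x + c * alpha * ((K1 + K2) / x)) * x) with (c * G)
          by (unfold G; field; lra).
        assert (G <= x * x) by nra. nra. }
      replace (3 * D x / x) with (3 / x * D x) by (field; lra).
      assert (3 / x * D x <= ((n - 1) / x + c * x - c * alpha * (p x + q x)) * D x)
        by (apply Rmult_le_compat_r; lra). lra.
    - intros x Hx. destruct (HR1 x ltac:(lra)) as [H1 _].
      change (/ tan (v x)) with (p x) in H1. specialize (Hq x Hx). unfold D.
      assert (K1 / x <= K1 * x ^ 2); [|lra].
      apply Rmult_le_reg_r with x; [lra|].
      replace (K1 / x * x) with K1 by (field; lra).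
      assert (1 <= x ^ 2 * x) by (assert (1 <= x * x) by nra; nra). nra. }
  assert (- D (s + 1) < 0).
  { apply (barrier_strict (fun x => - D x) (fun x => - dD x) s (s + 1)); [lra| | |].
    - intros x Hx; apply (is_derive_opp D), Hd; lra.
    - intros x Hx E0. assert (E1 : D x = 0) by lra. unfold dD; rewrite E1.
      specialize (Hq x ltac:(lra)).
      assert (0 < c * (beta - alpha) * q x ^ 2).
      { apply Rmult_lt_0_compat; [nra|apply pow_lt; lra]. } lra.
    - specialize (HD0 s ltac:(lra)); lra. }
  specialize (Hle (s + 1) ltac:(lra)); lra.
Qed.

(** The logarithm of the quotient has an integrable derivative. The factor
    [s] carries the sign of $f$. *)
Lemma sim_of_log_derivative (f h g gh : R -> R) (s r K : R) :
  0 < r ->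
  (forall x, r <= x -> 0 < s * f x /\ 0 < h x) ->
  (forall x, r <= x -> is_derive f x (f x * g x)) ->
  (forall x, r <= x -> is_derive h x (h x * gh x)) ->
  (forall x, r <= x -> Rabs (g x - gh x) <= K / x ^ 2) ->
  sim_infty f h.
Proof.
  intros Hr Hpos Hf Hh HK.
  assert (Hs : s <> 0).
  { intros ->; destruct (Hpos r (Rle_refl r)); lra. }
  destruct (is_lim_of_derive_bound (fun x => ln (s * f x / h x))
              (fun x => g x - gh x) r K Hr) as [l Hl]; trivial.
  { intros x Hx; specialize (Hf x Hx); specialize (Hh x Hx).
    destruct (Hpos x Hx) as [H1 H2].
    set (lf := f x * g x) in *. set (lh := h x * gh x) in *.
    assert (Hne : f x <> 0) by (intros E; rewrite E in H1; lra).
    assert (Hq : is_derive (fun x => s * f x / h x) x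
                   (s * f x / h x * (g x - gh x))).
    { evar_last; [apply is_derive_div; [apply is_derive_scal, Hf|exact Hh|lra]|].
      unfold lf, lh; field; lra. }
    evar_last.
    - apply (is_derive_comp ln (fun x => s * f x / h x)); [apply is_derive_ln|exact Hq].
      apply Rdiv_lt_0_compat; lra.
    - match goal with |- scal ?a ?b = _ => change (scal a b) with (a * b) end.
      field; repeat split; lra. }
  exists (exp l / s); split.
  { pose proof (exp_pos l). apply Rmult_integral_contrapositive; split; [lra|].
    apply Rinv_neq_0_compat; trivial. }
  apply (is_lim_ext_loc (fun x => exp (ln (s * f x / h x)) * / s)).
  { exists r; intros x Hx; destruct (Hpos x ltac:(lra)) as [H1 H2].
    rewrite exp_ln by (apply Rdiv_lt_0_compat; lra). field; lra. }
  apply (is_lim_scal_r _ (/ s) p_infty (exp l)).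
  apply (filterlim_comp _ _ _ (fun x => ln (s * f x / h x)) exp _ (locally l)); [exact Hl|].
  apply (ex_derive_continuous exp). auto_derive; trivial.
Qed.

(** * From a profile to its angle *)

Lemma is_derive_within_delta (D : R -> Prop) f x l e :
  is_derive_within D f x l -> 0 < e ->
  exists d, 0 < d /\ forall y, Rabs (y - x) < d -> y <> x -> D y ->
    Rabs ((f y - f x) / (y - x) - l) < e.
Proof.
  intros H He.
  destruct (H (ball l (mkposreal e He)) (locally_ball l (mkposreal e He))) as [d Hd].
  exists d; split; [apply cond_pos|]. intros y Hy Hyx HD.
  exact (Hd y Hy Hyx HD).
Qed.

Lemma is_derive_of_within f x l :
  0 < x -> is_derive_within nonneg_half f x l -> is_derive f x l.
Proof.
  intros Hx H. apply is_derive_Reals. intros e He.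
  destruct (is_derive_within_delta _ _ _ _ e H He) as [d [Hd Hd']].
  assert (Hm : 0 < Rmin d x) by (apply Rmin_glb_lt; trivial).
  exists (mkposreal _ Hm); simpl; intros h Hh Hhd.
  pose proof (Rmin_l d x); pose proof (Rmin_r d x).
  specialize (Hd' (x + h)). replace (x + h - x) with h in Hd' by ring.
  apply Hd'; [lra|lra|]. unfold nonneg_half.
  assert (Rabs h < x) by lra. apply Rabs_def2 in H2; lra.
Qed.

Lemma profile_near_0 f f1 e :
  is_derive_within nonneg_half f 0 (f1 0) -> continuous_on nonneg_half f1 ->
  f 0 = 1 -> f1 0 = 0 -> 0 < e ->
  exists d, 0 < d /\ forall x, 0 < x < d -> Rabs (f x - 1) < e /\ Rabs (f1 x) < e.
Proof.
  intros Hf Hf1 H0 H1 He.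
  destruct (is_derive_within_delta _ _ _ _ 1 Hf Rlt_0_1) as [d1 [Hd1 Hd1']].
  destruct (Hf1 0 (Rle_refl 0) (ball (f1 0) (mkposreal e He))
              (locally_ball (f1 0) (mkposreal e He))) as [d2 Hd2].
  pose proof (cond_pos d2).
  exists (Rmin (Rmin d1 d2) e); split; [repeat apply Rmin_glb_lt; trivial|].
  intros x Hx. pose proof (Rmin_l (Rmin d1 d2) e); pose proof (Rmin_r (Rmin d1 d2) e).
  pose proof (Rmin_l d1 d2); pose proof (Rmin_r d1 d2).
  split.
  - specialize (Hd1' x). rewrite H0, H1, !Rminus_0_r in Hd1'.
    rewrite (Rabs_pos_eq x) in Hd1' by lra.
    specialize (Hd1' ltac:(lra) ltac:(lra) ltac:(unfold nonneg_half; lra)).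
    replace (f x - 1) with ((f x - 1) / x * x) by (field; lra).
    rewrite Rabs_mult, (Rabs_pos_eq x) by lra.
    pose proof (Rabs_pos ((f x - 1) / x)). nra.
  - assert (Hb : ball 0 d2 x).
    { change (Rabs (x - 0) < d2). rewrite Rminus_0_r, Rabs_pos_eq; lra. }
    specialize (Hd2 x Hb ltac:(unfold nonneg_half; lra)).
    change (Rabs (f1 x - f1 0) < e) in Hd2. rewrite H1, Rminus_0_r in Hd2; exact Hd2.
Qed.

(** Backward uniqueness away from the singular point: on $[a, b]$ the energy
    $f^2 + f'^2$ decreases at most exponentially. *)
Lemma energy_pos (n gamma alpha : R) (f f1 f2 : R -> R) (a b : R) :
  1 <= n -> -1 < gamma < 1 -> 0 <= alpha -> 0 < a <= b ->
  (forall x, 0 < x -> is_derive f x (f1 x)) ->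
  (forall x, 0 < x -> is_derive f1 x (f2 x)) ->
  (forall x, 0 < x ->
     f2 x + (n - 1) / x * f1 x = reaction gamma (alpha * f x + x * f1 x)) ->
  0 < f a ^ 2 + f1 a ^ 2 -> 0 < f b ^ 2 + f1 b ^ 2.
Proof.
  intros Hn Hg Ha Hab Hf Hf1 Hode Hpos.
  set (L := 2 * ((n - 1) / a) + (1 + alpha) + 2 * b).
  set (E := fun x => f x ^ 2 + f1 x ^ 2).
  set (dE := fun x => 2 * f x * f1 x + 2 * f1 x * f2 x).
  assert (H : E a * exp (L * a) <= E b * exp (L * b)).
  { apply (nonneg_derive_le (fun x => E x * exp (L * x))
             (fun x => (dE x + L * E x) * exp (L * x))); [lra| |].
    - intros x Hx. specialize (Hf x ltac:(lra)); specialize (Hf1 x ltac:(lra)).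
      unfold E. auto_derive; [repeat split; trivial; [exists (f1 x)|exists (f2 x)]; trivial|].
      subst_derive Hf. subst_derive Hf1. unfold dE; ring.
    - intros x Hx. specialize (Hode x ltac:(lra)).
      pose proof (reaction_abs_le gamma (alpha * f x + x * f1 x) Hg) as Hr.
      set (S := reaction _ _) in *.
      apply Rmult_le_pos; [|apply Rlt_le, exp_pos].
      assert (E2 : f2 x = S - (n - 1) / x * f1 x) by lra.
      unfold dE, E; rewrite E2.
      assert (Hk : 0 <= (n - 1) / x <= (n - 1) / a).
      { split; [apply Rdiv_le_0_compat; lra|].
        apply Rmult_le_compat_l; [lra|]. apply Rinv_le_contravar; lra. }
      assert (HS : Rabs S <= alpha * Rabs (f x) + b * Rabs (f1 x)).
      { eapply Rle_trans; [exact Hr|]. eapply Rle_trans; [apply Rabs_triang|].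
        rewrite !Rabs_mult, (Rabs_pos_eq alpha), (Rabs_pos_eq x) by lra.
        pose proof (Rabs_pos (f1 x)). nra. }
      assert (HfS : - (Rabs (f1 x) * (alpha * Rabs (f x) + b * Rabs (f1 x))) <= f1 x * S).
      { assert (Rabs (f1 x * S) <= Rabs (f1 x) * (alpha * Rabs (f x) + b * Rabs (f1 x))).
        { rewrite Rabs_mult; apply Rmult_le_compat_l; [apply Rabs_pos|exact HS]. }
        apply Rabs_le_between in H; lra. }
      assert (Hff : - (Rabs (f x) * Rabs (f1 x)) <= f x * f1 x).
      { rewrite <- Rabs_mult. pose proof (Rle_abs (- (f x * f1 x))) as H.
        rewrite Rabs_Ropp in H; lra. }
      rewrite <- (pow2_abs (f x)), <- (pow2_abs (f1 x)).
      set (p := Rabs (f x)) in *; set (q := Rabs (f1 x)) in *.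
      assert (Hkq : (n - 1) / x * q ^ 2 <= (n - 1) / a * q ^ 2).
      { apply Rmult_le_compat_r; [apply pow2_ge_0|lra]. }
      assert (Hq2 : q ^ 2 = f1 x ^ 2) by apply pow2_abs.
      assert (Hpq : 0 <= (1 + alpha) * (p - q) ^ 2).
      { apply Rmult_le_pos; [lra|apply pow2_ge_0]. }
      assert (0 <= (n - 1) / a * p ^ 2) by (apply Rmult_le_pos; [lra|apply pow2_ge_0]).
      assert (0 <= b * p ^ 2) by (apply Rmult_le_pos; [lra|apply pow2_ge_0]).
      replace (2 * f x * f1 x + 2 * f1 x * (S - (n - 1) / x * f1 x))
        with (2 * (f x * f1 x) + 2 * (f1 x * S) - 2 * ((n - 1) / x * q ^ 2))
        by (rewrite Hq2; ring).
      unfold L; lra. }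
  pose proof (exp_pos (L * a)); pose proof (exp_pos (L * b)).
  fold (E a) in Hpos; fold (E b). nra.
Qed.

Definition polar (f th rho : R -> R) : Prop :=
  forall x, 0 < x -> 0 < rho x /\ f x = rho x * cos (th x) /\
    is_derive f x (- (rho x * sin (th x))).

(** Define $\theta$ by integrating the rate at which the vector $(f, -f')$ turns,
    and rotate the vector back by $\theta$ into $(u, -w)$. Then $w$ is proportional to
    the radius; it vanishes at [x0], hence everywhere, and $u$ is the radius. *)
Lemma prufer (f f1 f2 : R -> R) (x0 : R) :
  0 < x0 -> 0 < f x0 ->
  (forall x, 0 < x -> is_derive f x (f1 x)) ->
  (forall x, 0 < x -> is_derive f1 x (f2 x)) ->
  (forall x, 0 < x -> continuous f2 x) ->
  (forall x, 0 < x -> 0 < f x ^ 2 + f1 x ^ 2) ->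
  exists th rho : R -> R, th x0 = - atan (f1 x0 / f x0) /\
    forall x, 0 < x ->
      is_derive th x ((f1 x ^ 2 - f x * f2 x) / (f x ^ 2 + f1 x ^ 2)) /\
      0 < rho x /\ f x = rho x * cos (th x) /\ f1 x = - (rho x * sin (th x)).
Proof.
  intros Hx0 Hfx0 Hf Hf1 Hc Hr.
  set (r2 := fun x => f x ^ 2 + f1 x ^ 2).
  set (G := fun x => (f1 x ^ 2 - f x * f2 x) / r2 x).
  assert (HcG : forall x, 0 < x -> continuous G x).
  { intros x Hx.
    assert (Cf : continuous f x) by (apply (ex_derive_continuous f); exists (f1 x); auto).
    assert (Cf1 : continuous f1 x) by (apply (ex_derive_continuous f1); exists (f2 x); auto).
    specialize (Hc x Hx).
    assert (Csq : forall h : R -> R, continuous h x -> continuous (fun y => h y ^ 2) x).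
    { intros h Ch. apply (continuous_comp h (fun y => y ^ 2)); [exact Ch|].
      apply (ex_derive_continuous (fun y => y ^ 2)). auto_derive; trivial. }
    apply (continuous_mult (fun y => f1 y ^ 2 - f y * f2 y) (fun y => / r2 y)).
    - apply (continuous_minus (fun y => f1 y ^ 2) (fun y => f y * f2 y));
        [apply Csq, Cf1|apply (continuous_mult f f2); trivial].
    - apply continuous_Rinv_comp; [|specialize (Hr x Hx); unfold r2; lra].
      apply (continuous_plus (fun y => f y ^ 2) (fun y => f1 y ^ 2)); apply Csq; trivial. }
  set (th := fun x => - atan (f1 x0 / f x0) + RInt G x0 x).
  assert (Hth0 : th x0 = - atan (f1 x0 / f x0)).
  { unfold th; rewrite RInt_point. unfold zero; simpl; ring. }
  assert (Hdth : forall x, 0 < x -> is_derive th x (G x)).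
  { intros x Hx. unfold th. evar_last.
    - apply @is_derive_plus; [apply @is_derive_const|].
      apply (is_derive_RInt G (RInt G x0) x0 x); [|apply HcG, Hx].
      exists (mkposreal x Hx). intros y Hy. change (Rabs (y - x) < x) in Hy.
      apply Rabs_def2 in Hy. apply (RInt_correct (V := R_CompleteNormedModule)).
      apply (ex_RInt_continuous (V := R_CompleteNormedModule)).
      intros z Hz; apply HcG. unfold Rmin in Hz; destruct Rle_dec in Hz; lra.
    - unfold plus, zero; simpl; ring. }
  set (u := fun x => f x * cos (th x) - f1 x * sin (th x)).
  set (w := fun x => f x * sin (th x) + f1 x * cos (th x)).
  assert (Hsc : forall x, sin (th x) ^ 2 + cos (th x) ^ 2 = 1).
  { intros x; pose proof (sin2_cos2 (th x)); unfold Rsqr in *; lra. }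
  assert (Huw : forall x, u x ^ 2 + w x ^ 2 = r2 x).
  { intros x; unfold u, w, r2.
    transitivity ((f x ^ 2 + f1 x ^ 2) * (sin (th x) ^ 2 + cos (th x) ^ 2));
      [ring|rewrite Hsc; ring]. }
  assert (Hdu : forall x, 0 < x -> ex_derive u x).
  { intros x Hx; unfold u. auto_derive.
    repeat split; trivial; eexists; [apply Hf|apply Hdth|apply Hf1|apply Hdth]; trivial. }
  (* the choice of th' makes w'/w the logarithmic derivative of sqrt r2 *)
  assert (Hq : forall x, 0 < x -> is_derive (fun x => w x ^ 2 / r2 x) x 0).
  { intros x Hx. specialize (Hf x Hx); specialize (Hf1 x Hx); specialize (Hdth x Hx).
    specialize (Hr x Hx).
    assert (Hdw : is_derive w x ((f x * f1 x + f1 x * f2 x) / r2 x * w x)).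
    { unfold w. auto_derive.
      - repeat split; trivial; eexists; eassumption.
      - subst_derive Hf. subst_derive Hf1. subst_derive Hdth.
        unfold G, r2. specialize (Hsc x).
        set (s := sin (th x)) in *; set (c := cos (th x)) in *.
        field. lra. }
    assert (Hdr : is_derive r2 x (2 * (f x * f1 x + f1 x * f2 x))).
    { unfold r2. auto_derive; [repeat split; trivial; eexists; eassumption|].
      subst_derive Hf. subst_derive Hf1. ring. }
    set (l := _ / _ * _) in Hdw. set (l2 := 2 * _) in Hdr.
    change (0 < r2 x) in Hr.
    auto_derive; [repeat split; trivial; [exists l; exact Hdw|exists l2; exact Hdr|lra]|].
    subst_derive Hdw. subst_derive Hdr. unfold l, l2; field; lra. }
  pose proof (atan_bound (f1 x0 / f x0)) as Hat.
  assert (Hc0 : 0 < cos (th x0)) by (rewrite Hth0; apply cos_gt_0; lra).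
  assert (Hs0 : sin (th x0) = - (f1 x0 / f x0) * cos (th x0)).
  { rewrite Hth0, sin_neg, cos_neg.
    rewrite (sin_tan_cos (atan _)), tan_atan; [ring|apply cos_gt_0; lra]. }
  assert (Hw : forall x, 0 < x -> w x = 0).
  { intros x Hx.
    assert (Hw0 : w x0 = 0) by (unfold w; rewrite Hs0; field; lra).
    assert (E : w x ^ 2 / r2 x = w x0 ^ 2 / r2 x0).
    { destruct (Rle_dec x x0).
      - apply Rle_antisym;
          [apply (nonneg_derive_le (fun x => w x ^ 2 / r2 x) (fun _ => 0))
          |apply (nonpos_derive_le (fun x => w x ^ 2 / r2 x) (fun _ => 0))]; trivial;
          intros; try apply Hq; lra.
      - apply Rle_antisym;
          [apply (nonpos_derive_le (fun x => w x ^ 2 / r2 x) (fun _ => 0))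
          |apply (nonneg_derive_le (fun x => w x ^ 2 / r2 x) (fun _ => 0))]; try lra;
          intros; try apply Hq; lra. }
    rewrite Hw0 in E. pose proof (Hr x Hx) as Hrx; change (0 < r2 x) in Hrx.
    assert (w x ^ 2 = 0).
    { replace (w x ^ 2) with (w x ^ 2 / r2 x * r2 x) by (field; lra).
      rewrite E; unfold Rdiv; ring. }
    nra. }
  assert (Hune : forall x, 0 < x -> u x <> 0).
  { intros x Hx E. specialize (Huw x). rewrite E, (Hw x Hx) in Huw.
    pose proof (Hr x Hx) as Hrx; change (0 < r2 x) in Hrx. lra. }
  assert (Hu0 : 0 < u x0).
  { unfold u; rewrite Hs0.
    replace (f x0 * cos (th x0) - f1 x0 * (- (f1 x0 / f x0) * cos (th x0)))
      with (cos (th x0) * (r2 x0 / f x0)) by (unfold r2; field; lra).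
    apply Rmult_lt_0_compat; trivial. apply Rdiv_lt_0_compat; trivial. apply Hr, Hx0. }
  assert (Hu : forall x, 0 < x -> 0 < u x).
  { intros x Hx. destruct (Rlt_dec 0 (u x)) as [|Hn]; [trivial|exfalso].
    destruct (Rle_dec x x0).
    - destruct (last_hit u x x0) as [c [Hcx [E _]]]; trivial; try lra.
      + intros z Hz; apply Hdu; lra.
      + apply (Hune c); trivial; lra.
    - destruct (first_hit (fun x => - u x) x0 x) as [c [Hcx [E _]]]; try lra.
      + intros z Hz; apply @ex_derive_opp, Hdu; lra.
      + apply (Hune c); lra. }
  exists th, u; split; [exact Hth0|]. intros x Hx.
  split; [apply Hdth, Hx|split; [apply Hu, Hx|]].
  specialize (Hw x Hx); specialize (Hsc x).
  assert (Ef : f x = u x * cos (th x) + w x * sin (th x)).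
  { unfold u, w. transitivity (f x * (sin (th x) ^ 2 + cos (th x) ^ 2));
      [rewrite Hsc; ring|ring]. }
  assert (Ef1 : f1 x = - (u x * sin (th x)) + w x * cos (th x)).
  { unfold u, w. transitivity (f1 x * (sin (th x) ^ 2 + cos (th x) ^ 2));
      [rewrite Hsc; ring|ring]. }
  rewrite Hw in Ef, Ef1; split; lra.
Qed.

Lemma profile_angle (N : nat) gamma alpha f :
  (1 <= N)%nat -> -1 < gamma < 1 -> 0 <= alpha -> is_profile N gamma alpha f ->
  exists th, shooting_angle (INR N) gamma alpha th /\ exists rho, polar f th rho.
Proof.
  intros HN Hg Ha [f1 [f2 [Hf [Hcf1 [Hf1 [Hcf2 [Hode [H0 H1]]]]]]]].
  assert (Hn : 1 <= INR N) by (apply (le_INR 1 N), HN).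
  pose proof (Hf 0 (Rle_refl 0)) as Hf0.
  assert (Hdf : forall x, 0 < x -> is_derive f x (f1 x)).
  { intros x Hx; apply is_derive_of_within; [exact Hx|apply Hf; lra]. }
  clear Hf.
  pose proof (fun e => profile_near_0 f f1 e Hf0 Hcf1 H0 H1) as Hnear.
  destruct (Hnear (/ 2) ltac:(lra)) as [d [Hd Hd']].
  set (x0 := d / 2).
  assert (Hfpos : forall x, 0 < x <= x0 -> / 2 < f x).
  { intros x Hx; destruct (Hd' x ltac:(unfold x0 in *; lra)) as [H _].
    apply Rabs_def2 in H; lra. }
  assert (Hr : forall x, 0 < x -> 0 < f x ^ 2 + f1 x ^ 2).
  { intros x Hx. set (a := Rmin x x0).
    assert (Hax : 0 < a <= x /\ a <= x0).
    { unfold a, x0, Rmin; destruct Rle_dec; lra. }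
    apply (energy_pos (INR N) gamma alpha f f1 f2 a x); trivial; [lra|].
    specialize (Hfpos a ltac:(lra)). pose proof (pow2_ge_0 (f1 a)). nra. }
  assert (Hc2 : forall x, 0 < x -> continuous f2 x).
  { intros x Hx; apply (continuous_continuous_on pos_half); [|exact Hcf2].
    apply (open_gt 0); exact Hx. }
  assert (Hx0 : 0 < x0) by (unfold x0; lra).
  destruct (prufer f f1 f2 x0 Hx0) as [th [rho [Hth0 Hth]]]; trivial.
  { specialize (Hfpos x0); lra. }
  exists th; split; [split|].
  - intros x Hx. destruct (Hth x Hx) as [Hdth [Hrho [Ef Ef1]]].
    specialize (Hode x Hx). specialize (Hr x Hx).
    evar_last; [exact Hdth|].
    change (sigma_gamma gamma (alpha * f x + x * f1 x) * (alpha * f x + x * f1 x))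
      with (reaction gamma (alpha * f x + x * f1 x)) in Hode.
    replace (alpha * f x + x * f1 x)
      with (rho x * (alpha * cos (th x) - x * sin (th x))) in Hode
      by (rewrite Ef, Ef1; ring).
    rewrite reaction_scale in Hode by lra.
    unfold angle_field. set (S := reaction _ _) in *.
    assert (Ef2 : f2 x = rho x * S - (INR N - 1) / x * f1 x) by lra.
    assert (Hr2 : f x ^ 2 + f1 x ^ 2 = rho x ^ 2).
    { rewrite Ef, Ef1. pose proof (sin2_cos2 (th x)) as E; unfold Rsqr in E.
      transitivity (rho x ^ 2 * (sin (th x) * sin (th x) + cos (th x) * cos (th x)));
        [ring|rewrite E; ring]. }
    rewrite Hr2, Ef2, Ef, Ef1. field; lra.
  - intros e He.
    destruct (ex_derive_nbhd atan 0 e) as [k [Hk Hk']];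
      [exists (/ (1 + 0²)); apply is_derive_atan|exact He|].
    destruct (Hnear (Rmin (/ 2) (k / 2)) ltac:(apply Rmin_glb_lt; lra)) as [d1 [Hd1 Hd1']].
    exists (Rmin d1 x0); split; [apply Rmin_glb_lt; trivial|]. intros x Hx.
    pose proof (Rmin_l d1 x0); pose proof (Rmin_r d1 x0).
    assert (E : th x = - atan (f1 x / f x)).
    { set (h := fun y => th y + atan (f1 y / f y)).
      assert (Hh : forall y, x <= y <= x0 -> is_derive h y 0).
      { intros y Hy. destruct (Hth y ltac:(lra)) as [Hdth _].
        specialize (Hfpos y ltac:(lra)). specialize (Hr y ltac:(lra)).
        specialize (Hdf y ltac:(lra)); specialize (Hf1 y ltac:(lra)).
        evar_last.
        - apply (is_derive_plus th (fun z => atan (f1 z / f z))); [exact Hdth|].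
          apply (is_derive_comp atan (fun z => f1 z / f z)); [apply is_derive_atan|].
          apply is_derive_div; [exact Hf1|exact Hdf|lra].
        - match goal with |- plus ?a (scal ?b ?c) = _ =>
            change (plus a (scal b c)) with (a + b * c) end.
          unfold Rsqr. field. repeat split; nra. }
      assert (Ehh : h x = h x0).
      { apply Rle_antisym; [apply (nonneg_derive_le h (fun _ => 0))
                           |apply (nonpos_derive_le h (fun _ => 0))]; trivial;
          intros; lra. }
      unfold h in Ehh. rewrite Hth0 in Ehh. lra. }
    specialize (Hk' (f1 x / f x)). rewrite atan_0, !Rminus_0_r in Hk'.
    rewrite E, Rabs_Ropp; apply Hk'.
    destruct (Hd1' x ltac:(lra)) as [_ Hf1x].
    pose proof (Rmin_r (/ 2) (k / 2)).
    specialize (Hfpos x ltac:(lra)).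
    unfold Rdiv; rewrite Rabs_mult, Rabs_inv, (Rabs_pos_eq (f x)) by lra.
    apply Rmult_lt_reg_r with (f x); [lra|].
    rewrite Rmult_assoc, Rinv_l, Rmult_1_r by lra. nra.
  - exists rho; intros x Hx. destruct (Hth x Hx) as [_ [Hrho [Ef Ef1]]].
    split; [exact Hrho|split; [exact Ef|]]. rewrite <- Ef1; apply Hdf, Hx.
Qed.

(** * Asymptotics of the profile *)

Lemma cos_shift k x : cos (x + INR k * PI) = (-1) ^ k * cos x.
Proof.
  induction k as [|k IH].
  - simpl; rewrite Rmult_0_l, Rplus_0_r, Rmult_1_l; trivial.
  - replace (x + INR (S k) * PI) with (x + INR k * PI + PI) by (rewrite S_INR; ring).
    rewrite neg_cos, IH; simpl; ring.
Qed.

Lemma sin_shift k x : sin (x + INR k * PI) = (-1) ^ k * sin x.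
Proof.
  induction k as [|k IH].
  - simpl; rewrite Rmult_0_l, Rplus_0_r, Rmult_1_l; trivial.
  - replace (x + INR (S k) * PI) with (x + INR k * PI + PI) by (rewrite S_INR; ring).
    rewrite neg_sin, IH; simpl; ring.
Qed.

(** Within the half-turn of index [k] around $k\pi$ the sign of $f$ is
    $(-1)^k$. *)
Lemma polar_log_derivative f th rho k x :
  polar f th rho -> 0 < x -> - (PI / 2) < th x - INR k * PI < PI / 2 ->
  0 < (-1) ^ k * f x /\ is_derive f x (f x * - tan (th x - INR k * PI)).
Proof.
  intros Hp Hx Hv. destruct (Hp x Hx) as [Hrho [Ef Hd]].
  set (v := th x - INR k * PI) in *.
  assert (Hth : th x = v + INR k * PI) by (unfold v; ring).
  assert (Hc : 0 < cos v) by (apply cos_gt_0; lra).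
  rewrite Hth, cos_shift in Ef; rewrite Hth, sin_shift in Hd.
  assert (Hsq : (-1) ^ k * (-1) ^ k = 1).
  { rewrite <- Rpow_mult_distr. replace (-1 * -1) with 1 by ring. apply pow1. }
  split.
  - rewrite Ef. replace ((-1) ^ k * (rho x * ((-1) ^ k * cos v)))
      with (((-1) ^ k * (-1) ^ k) * (rho x * cos v)) by ring.
    rewrite Hsq; nra.
  - evar_last; [exact Hd|]. rewrite Ef, (sin_tan_cos v Hc); ring.
Qed.

Lemma is_derive_Rpower_l b x :
  0 < x -> is_derive (fun y => Rpower y b) x (Rpower x b * (b / x)).
Proof. intros Hx; unfold Rpower. auto_derive; [lra|field; lra]. Qed.

Lemma slow_asymptotics n gamma alpha th f rho k :
  1 <= n -> -1 < gamma < 1 -> 0 < alpha ->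
  angle_ode n gamma alpha th -> polar f th rho -> tail_slow alpha k th ->
  sim_infty f (fun eta => Rpower eta (- alpha)).
Proof.
  intros Hn Hg Ha Ho Hp [r [Hr Ht]].
  destruct (slow_rate n ((-1) ^ k * gamma) alpha (fun x => th x - INR k * PI) r)
    as [K [r1 [Hr1 HK]]]; trivial.
  { apply sign_range, Hg. }
  { apply angle_ode_shift, Ho. }
  set (r2 := Rmax r1 1).
  assert (Hr2 : r1 <= r2 /\ 1 <= r2) by (split; [apply Rmax_l|apply Rmax_r]).
  assert (Hf : forall x, r2 <= x -> 0 < (-1) ^ k * f x /\
             is_derive f x (f x * - tan (th x - INR k * PI))).
  { intros x Hx; specialize (Ht x ltac:(lra)).
    pose proof (atan_bound ((alpha + 1) / x)).
    apply (polar_log_derivative f th rho); trivial; lra. }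
  apply (sim_of_log_derivative f _ (fun x => - tan (th x - INR k * PI))
           (fun x => - alpha / x) ((-1) ^ k) r2 K); [lra| | | |].
  - intros x Hx; split; [apply Hf, Hx|apply exp_pos].
  - intros x Hx; apply Hf, Hx.
  - intros x Hx; apply is_derive_Rpower_l; lra.
  - intros x Hx; specialize (HK x ltac:(lra)). cbv beta in HK.
    replace (- tan (th x - INR k * PI) - - alpha / x)
      with ((alpha - x * tan (th x - INR k * PI)) / x) by (field; lra).
    unfold Rdiv at 1. rewrite Rabs_mult, (Rabs_pos_eq (/ x)).
    2:{ apply Rlt_le, Rinv_0_lt_compat; lra. }
    assert (/ x <= 1) by (rewrite <- Rinv_1; apply Rinv_le_contravar; lra).
    pose proof (Rabs_pos (alpha - x * tan (th x - INR k * PI))). nra.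
Qed.

Lemma tail_fast_angle alpha k th :
  0 < alpha -> tail_fast alpha k th ->
  exists r, 0 < r /\ forall x, r <= x ->
    0 < atan ((alpha + 1) / x) <= th x - INR k * PI /\ th x - INR k * PI < PI / 2.
Proof.
  intros Ha [r [Hr Ht]]; exists r; split; [trivial|]. intros x Hx.
  specialize (Ht x Hx).
  assert (0 < atan ((alpha + 1) / x)); [|lra].
  rewrite <- atan_0; apply atan_increasing, Rdiv_lt_0_compat; lra.
Qed.

Lemma fast_asymptotics n gamma alpha th f rho k :
  1 <= n -> -1 < gamma < 1 -> 0 < alpha ->
  angle_ode n gamma alpha th -> polar f th rho -> tail_fast alpha k th ->
  sim_infty f (fun eta => Rpower eta (alpha - n)
                 * exp (- ((1 + (-1) ^ k * gamma) / 4 * eta ^ 2))).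
Proof.
  intros Hn Hg Ha Ho Hp Ht.
  destruct (tail_fast_angle _ _ _ Ha Ht) as [r [Hr Ht']].
  destruct (fast_rate n ((-1) ^ k * gamma) alpha (fun x => th x - INR k * PI) r)
    as [K [r1 [Hr1 [HK0 HK]]]]; trivial.
  { apply sign_range, Hg. }
  { apply angle_ode_shift, Ho. }
  { intros x Hx; specialize (Ht' x Hx); lra. }
  assert (Hf : forall x, r1 <= x -> 0 < (-1) ^ k * f x /\
             is_derive f x (f x * - tan (th x - INR k * PI))).
  { intros x Hx; specialize (Ht' x ltac:(lra)).
    apply (polar_log_derivative f th rho); trivial; lra. }
  set (c := (1 + (-1) ^ k * gamma) / 2) in *.
  apply (sim_of_log_derivative f _ (fun x => - tan (th x - INR k * PI))
           (fun x => (alpha - n) / x - c * x) ((-1) ^ k) r1 K); [lra| | | |].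
  - intros x Hx; split; [apply Hf, Hx|]. apply Rmult_lt_0_compat; apply exp_pos.
  - intros x Hx; apply Hf, Hx.
  - intros x Hx. evar_last.
    + apply (is_derive_mult (fun y => Rpower y (alpha - n))
               (fun y => exp (- ((1 + (-1) ^ k * gamma) / 4 * y ^ 2))));
        [apply is_derive_Rpower_l; lra| |intros; apply Rmult_comm].
      auto_derive; [trivial|reflexivity].
    + unfold plus, mult; simpl. unfold c; field; lra.
  - intros x Hx; destruct (HK x Hx) as [_ H]. cbv beta in H.
    rewrite <- Rabs_Ropp. eapply Rle_trans; [|exact H]. apply Req_le; f_equal; ring.
Qed.

(** * The thresholds *)

(** In terms of the profile: $f$ has at least $k+1$ zeros. *)
Definition turns_past (th : R -> R) (k : nat) : Prop :=
  exists eta, 0 < eta /\ INR k * PI + PI / 2 < th eta.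

Lemma turns_past_le th j k : (j <= k)%nat -> turns_past th k -> turns_past th j.
Proof.
  intros Hjk [x [Hx H]]; exists x; split; [trivial|].
  apply le_INR in Hjk; pose proof PI_RGT_0. nra.
Qed.

Lemma turns_past_mono n gamma alpha beta th1 th2 k :
  1 <= n -> -1 < gamma < 1 -> 0 <= alpha <= beta ->
  shooting_angle n gamma alpha th1 -> shooting_angle n gamma beta th2 ->
  turns_past th1 k -> turns_past th2 k.
Proof.
  intros Hn Hg Hab H1 H2 [x [Hx H]]; exists x; split; [trivial|].
  pose proof (angle_comparison n gamma alpha beta th1 th2 Hn Hg Hab H1 H2 x Hx); lra.
Qed.

Lemma turns_past_later n gamma alpha th k x y :
  angle_ode n gamma alpha th -> 0 < x < y ->
  INR k * PI + PI / 2 <= th x -> INR k * PI + PI / 2 < th y.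
Proof.
  intros Ho Hxy H.
  pose proof (angle_upcrossing n gamma alpha th (S k) x y Ho Hxy) as Hu.
  rewrite S_INR in Hu; lra.
Qed.

Lemma tail_turns n gamma alpha th k j r :
  angle_ode n gamma alpha th -> 0 < r ->
  (forall x, r <= x -> - (PI / 2) < th x - INR k * PI < PI / 2) ->
  turns_past th j <-> (j < k)%nat.
Proof.
  intros Ho Hr Ht; pose proof PI_RGT_0 as HPI; split.
  - intros [x [Hx H]].
    pose proof (turns_past_later n gamma alpha th j x (Rmax x r + 1) Ho) as Hl.
    pose proof (Rmax_l x r); pose proof (Rmax_r x r).
    specialize (Hl ltac:(lra) ltac:(lra)). specialize (Ht (Rmax x r + 1) ltac:(lra)).
    apply INR_lt. nra.
  - intros Hjk; exists r; split; [trivial|]. specialize (Ht r (Rle_refl r)).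
    apply le_INR in Hjk; rewrite S_INR in Hjk. nra.
Qed.

Lemma tail_slow_turns n gamma alpha th k j :
  angle_ode n gamma alpha th -> tail_slow alpha k th ->
  turns_past th j <-> (j < k)%nat.
Proof.
  intros Ho [r [Hr Ht]]; apply (tail_turns n gamma alpha th k j r); trivial.
  intros x Hx; specialize (Ht x Hx); pose proof (atan_bound ((alpha + 1) / x)); lra.
Qed.

Lemma tail_fast_turns n gamma alpha th k j :
  0 < alpha -> angle_ode n gamma alpha th -> tail_fast alpha k th ->
  turns_past th j <-> (j < k)%nat.
Proof.
  intros Ha Ho Ht; destruct (tail_fast_angle _ _ _ Ha Ht) as [r [Hr Ht']].
  apply (tail_turns n gamma alpha th k j r); trivial.
  intros x Hx; specialize (Ht' x Hx); pose proof PI_RGT_0; lra.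
Qed.

Lemma turns_past_open n gamma T alpha k :
  1 <= n -> -1 < gamma < 1 ->
  (forall a, 0 < a -> shooting_angle n gamma a (T a)) ->
  0 < alpha -> turns_past (T alpha) k ->
  exists beta, 0 < beta < alpha /\ turns_past (T beta) k.
Proof.
  intros Hn Hg HT Ha [x [Hx H]].
  destruct (angle_lipschitz n gamma alpha (T alpha) x Hn Hg ltac:(lra) (HT alpha Ha) Hx)
    as [K [HK HL]].
  set (e := T alpha x - (INR k * PI + PI / 2)).
  assert (He : 0 < e) by (unfold e; lra).
  set (d := Rmin (alpha / 2) (e / (2 * K))).
  assert (HeK : 0 < e / (2 * K)) by (apply Rdiv_lt_0_compat; lra).
  assert (Hd : 0 < d <= alpha / 2 /\ d <= e / (2 * K)).
  { unfold d; split; [split; [apply Rmin_glb_lt; lra|apply Rmin_l]|apply Rmin_r]. }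
  exists (alpha - d); split; [lra|]. exists x; split; [trivial|].
  specialize (HL (alpha - d) alpha (T (alpha - d)) (T alpha) ltac:(lra) ltac:(lra)
                (HT (alpha - d) ltac:(lra)) (HT alpha Ha)).
  assert (e / (2 * K) * (2 * K) = e) by (field; lra).
  assert (K * d <= K * (e / (2 * K))) by (apply Rmult_le_compat_l; lra).
  replace (alpha - (alpha - d)) with d in HL by ring. unfold e in *; lra.
Qed.

(** The barrier for $C = \alpha + 1$ works for all exponents near $\alpha$ at one
    common radius. There the angle depends continuously on the exponent, so slightly
    larger exponents are trapped as well. The exponent [alpha] may be 0, which
    provides an exponent without any zero. *)
Lemma trapped_open n gamma T alpha th k r :
  1 <= n -> -1 < gamma < 1 ->
  (forall a, 0 < a -> shooting_angle n gamma a (T a)) ->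
  0 <= alpha -> shooting_angle n gamma alpha th -> 0 < r ->
  (forall x, r <= x -> th x - INR k * PI < atan ((alpha + 1) / x)) ->
  exists beta, alpha < beta /\ ~ turns_past (T beta) k.
Proof.
  intros Hn Hg HT Ha Hs Hr Ht.
  destruct (trap_radius gamma (alpha + / 2) (alpha + 1) Hg ltac:(lra)) as [r1 [Hr1 Htr]].
  set (x := Rmax r r1).
  assert (Hx : r <= x /\ r1 <= x) by (split; [apply Rmax_l|apply Rmax_r]).
  destruct (angle_lipschitz n gamma (alpha + / 2) (T (alpha + / 2)) x Hn Hg ltac:(lra)
              (HT (alpha + / 2) ltac:(lra)) ltac:(lra)) as [K [HK HL]].
  set (e := atan ((alpha + 1) / x) - (th x - INR k * PI)).
  assert (He : 0 < e) by (specialize (Ht x ltac:(lra)); unfold e; lra).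
  set (d := Rmin (/ 2) (e / K)).
  assert (HeK : 0 < e / K) by (apply Rdiv_lt_0_compat; lra).
  assert (Hd : 0 < d <= / 2 /\ d <= e / K).
  { unfold d; split; [split; [apply Rmin_glb_lt; lra|apply Rmin_l]|apply Rmin_r]. }
  set (beta := alpha + d). pose proof (HT beta ltac:(unfold beta; lra)) as Hsb.
  specialize (HL alpha beta th (T beta) ltac:(unfold beta; lra) ltac:(unfold beta; lra) Hs Hsb).
  assert (e / K * K = e) by (field; lra).
  assert (Hstart : T beta x - INR k * PI <= atan ((alpha + 1) / x)).
  { replace (beta - alpha) with d in HL by (unfold beta; ring).
    assert (K * d <= K * (e / K)) by (apply Rmult_le_compat_l; lra). unfold e in *; lra. }
  exists beta; split; [unfold beta; lra|]. intros [y [Hy HT1]].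
  pose proof (Rmax_l x y); pose proof (Rmax_r x y).
  set (z := Rmax x y + 1) in *.
  pose proof (turns_past_later n gamma beta (T beta) k y z (proj1 Hsb)
                ltac:(unfold z; lra) ltac:(lra)) as Hz.
  pose proof (angle_downcrossing n gamma beta (T beta) k (alpha + 1) x z Hn Hg
                ltac:(unfold beta; lra) (proj1 Hsb) ltac:(unfold z; lra)) as Hdn.
  specialize (Htr x ltac:(lra)).
  pose proof (damping_pos gamma Hg) as Hm.
  assert (Hm2 : 0 <= damping gamma * x ^ 2) by (pose proof (pow2_ge_0 x); nra).
  assert (damping gamma * x ^ 2 * (alpha + 1 - (alpha + / 2))
          <= damping gamma * x ^ 2 * (alpha + 1 - beta)).
  { apply Rmult_le_compat_l; [lra|unfold beta; lra]. }
  specialize (Hdn ltac:(lra) Hstart).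
  pose proof (atan_bound ((alpha + 1) / z)). lra.
Qed.

(** Passing a level is monotone and open in the exponent, so the exponents that
    do not pass it form an interval with a largest element. *)
Lemma turns_threshold n gamma T k :
  1 <= n -> -1 < gamma < 1 ->
  (forall a, 0 < a -> shooting_angle n gamma a (T a)) ->
  exists a, 0 < a /\ ~ turns_past (T a) k /\ forall b, a < b -> turns_past (T b) k.
Proof.
  intros Hn Hg HT.
  destruct (trapped_open n gamma T 0 (fun _ => 0) 0 1 Hn Hg HT (Rle_refl 0)
              (zero_shooting_angle n gamma) Rlt_0_1) as [a0 [Ha0 Hno]].
  { intros x Hx; simpl INR; rewrite Rmult_0_l, Rminus_0_r, <- atan_0 at 1.
    apply atan_increasing, Rdiv_lt_0_compat; lra. }
  destruct (many_half_turns n gamma k Hn Hg) as [a1 [Ha1 Hyes]].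
  specialize (Hyes (T a1) (HT a1 Ha1)). change (turns_past (T a1) k) in Hyes.
  assert (Hup : forall a b, 0 < a -> a <= b -> turns_past (T a) k -> turns_past (T b) k).
  { intros a b Ha Hab. apply (turns_past_mono n gamma a b); trivial; try lra;
      apply HT; lra. }
  destruct (completeness (fun a => 0 < a /\ ~ turns_past (T a) k)) as [a [Hu Hl]].
  { exists a1; intros b [Hb Hnb]. apply Rnot_lt_le; intros Hlt.
    apply Hnb, (Hup a1); trivial; lra. }
  { exists a0; split; [lra|]. intros H; apply Hno, (turns_past_le _ 0 k); trivial; lia. }
  assert (Ha : 0 < a).
  { apply Rlt_le_trans with a0; [lra|]. apply Hu; split; [lra|].
    intros H; apply Hno, (turns_past_le _ 0 k); trivial; lia. }
  exists a; split; [exact Ha|split].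
  - intros H. destruct (turns_past_open n gamma T a k Hn Hg HT Ha H) as [b [Hb Hb']].
    assert (a <= b); [|lra]. apply Hl; intros z [Hz Hz'].
    apply Rnot_lt_le; intros Hlt. apply Hz', (Hup b); trivial; lra.
  - intros b Hb. apply NNPP; intros H.
    assert (b <= a); [|lra]. apply Hu; split; [lra|exact H].
Qed.

(** A slow tail, or a fast tail of index below [k], is trapped below a level
    that some larger exponent still would not pass, whereas all larger exponents
    pass the level [k]. *)
Lemma threshold_fast n gamma T k a :
  1 <= n -> -1 < gamma < 1 ->
  (forall a, 0 < a -> shooting_angle n gamma a (T a)) ->
  0 < a -> ~ turns_past (T a) k -> (forall b, a < b -> turns_past (T b) k) ->
  tail_fast a k (T a).
Proof.
  intros Hn Hg HT Ha Hno Hyes. pose proof (HT a Ha) as Hs.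
  destruct (tail_dichotomy n gamma a (T a) Hn Hg Ha Hs) as [j [Hslow|Hfast]].
  - exfalso. pose proof (tail_slow_turns n gamma a (T a) j k (proj1 Hs) Hslow) as Hiff.
    destruct Hslow as [r [Hr Ht]].
    destruct (trapped_open n gamma T a (T a) j r Hn Hg HT ltac:(lra) Hs Hr) as [b [Hb Hnb]].
    { intros x Hx; apply Ht, Hx. }
    apply Hnb, (turns_past_le _ j k); [|apply Hyes, Hb].
    destruct (Nat.le_gt_cases j k); [trivial|]. exfalso; tauto.
  - pose proof (tail_fast_turns n gamma a (T a) j k Ha (proj1 Hs) Hfast) as Hiff.
    assert (Hjk : (j <= k)%nat) by (destruct (Nat.le_gt_cases j k); tauto).
    destruct (Nat.eq_dec j k) as [->|Hne]; [exact Hfast|exfalso].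
    destruct (tail_fast_angle _ _ _ Ha Hfast) as [r [Hr Ht]].
    destruct (trapped_open n gamma T a (T a) (S j) r Hn Hg HT ltac:(lra) Hs Hr)
      as [b [Hb Hnb]].
    { intros x Hx; specialize (Ht x Hx). rewrite S_INR. pose proof PI_RGT_0. lra. }
    apply Hnb, (turns_past_le _ (S j) k); [lia|apply Hyes, Hb].
Qed.

Lemma tail_fast_unique n gamma T k a b :
  1 <= n -> -1 < gamma < 1 ->
  (forall a, 0 < a -> shooting_angle n gamma a (T a)) ->
  0 < a -> tail_fast a k (T a) -> tail_fast b k (T b) -> ~ a < b.
Proof.
  intros Hn Hg HT Ha [r1 [Hr1 H1]] [r2 [Hr2 H2]] Hab.
  pose proof (HT a Ha) as Hsa; pose proof (HT b ltac:(lra)) as Hsb.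
  pose proof (Rmax_l r1 r2); pose proof (Rmax_r r1 r2).
  apply (fast_unique n ((-1) ^ k * gamma) a b (fun x => T a x - INR k * PI)
           (fun x => T b x - INR k * PI) (Rmax r1 r2)); trivial; try lra.
  - apply sign_range, Hg.
  - apply angle_ode_shift, Hsa.
  - apply angle_ode_shift, Hsb.
  - intros x Hx; apply H1; lra.
  - intros x Hx; apply H2; lra.
  - intros x Hx.
    pose proof (angle_comparison n gamma a b (T a) (T b) Hn Hg ltac:(lra) Hsa Hsb x
                  ltac:(lra)); lra.
Qed.

Theorem theorem1p1 (N : nat) (gamma : R) (f : R -> R -> R)
  (hN : (1 <= N)%nat) (hgamma : -1 < gamma < 1)
  (hf : forall alpha : R, 0 < alpha -> is_profile N gamma alpha (f alpha)) :
  exists a : nat -> R,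
    0 < a 0%nat /\
    (forall k : nat, a k < a (S k)) /\
    (forall M : R, exists k : nat, M < a k) /\
    (forall k : nat,
       sim_infty (f (a k))
         (fun eta => Rpower eta (a k - INR N)
                     * exp (- ((1 + (-1) ^ k * gamma) / 4 * eta ^ 2)))) /\
    (forall alpha : R, 0 < alpha -> (forall k : nat, alpha <> a k) ->
       sim_infty (f alpha) (fun eta => Rpower eta (- alpha))).
Proof.
  assert (Hn : 1 <= INR N) by (apply (le_INR 1 N), hN).
  destruct (functional_choice (fun (alpha : R) (th : R -> R) => 0 < alpha ->
    shooting_angle (INR N) gamma alpha th /\ exists rho, polar (f alpha) th rho))
    as [T HTp].
  { intros alpha. destruct (Rlt_dec 0 alpha) as [Ha|Ha].
    - destruct (profile_angle N gamma alpha (f alpha)) as [th Hth]; auto; [lra|].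
      exists th; intros _; exact Hth.
    - exists (fun _ => 0); intros; contradiction. }
  assert (HT : forall a, 0 < a -> shooting_angle (INR N) gamma a (T a))
    by (intros a Ha; apply HTp, Ha).
  destruct (functional_choice (fun k a => 0 < a /\ ~ turns_past (T a) k /\
    forall b, a < b -> turns_past (T b) k)) as [a Hak].
  { intros k; apply (turns_threshold (INR N) gamma T k Hn hgamma HT). }
  assert (Hfast : forall k, tail_fast (a k) k (T (a k))).
  { intros k; destruct (Hak k) as [H1 [H2 H3]].
    apply (threshold_fast (INR N) gamma T); trivial. }
  exists a; split; [apply Hak|split; [|split; [|split]]].
  - intros k. destruct (Hak k) as [Hp [Hno Hyes]].
    destruct (Hak (S k)) as [Hp' [Hno' Hyes']].
    destruct (Rtotal_order (a k) (a (S k))) as [H|[H|H]]; [exact H|exfalso|exfalso].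
    + apply Hno. rewrite H.
      apply (tail_fast_turns (INR N) gamma (a (S k)) (T (a (S k))) (S k)); trivial; [|lia].
      apply HT, Hp'.
    + apply Hno, (turns_past_le _ k (S k)); [lia|apply Hyes', H].
  - intros M. apply NNPP; intros Hbd.
    assert (Hle : forall k, a k <= M).
    { intros k; apply Rnot_lt_le; intros H; apply Hbd; exists k; exact H. }
    assert (HM : 0 < M + 1) by (destruct (Hak 0%nat) as [H _]; specialize (Hle 0%nat); lra).
    assert (Hall : forall k, turns_past (T (M + 1)) k).
    { intros k; apply (Hak k). specialize (Hle k); lra. }
    destruct (tail_dichotomy (INR N) gamma (M + 1) (T (M + 1)) Hn hgamma HM (HT _ HM))
      as [j [Hj|Hj]].
    + apply (tail_slow_turns (INR N) gamma _ _ j j (proj1 (HT _ HM))) in Hj.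
      specialize (proj1 Hj (Hall j)); lia.
    + apply (tail_fast_turns (INR N) gamma _ _ j j HM (proj1 (HT _ HM))) in Hj.
      specialize (proj1 Hj (Hall j)); lia.
  - intros k. destruct (Hak k) as [Hp _]. destruct (HTp (a k) Hp) as [Hs [rho Hrho]].
    apply (fast_asymptotics (INR N) gamma (a k) (T (a k)) (f (a k)) rho k);
      trivial; apply Hs.
  - intros alpha Ha Hne. destruct (HTp alpha Ha) as [Hs [rho Hrho]].
    destruct (tail_dichotomy (INR N) gamma alpha (T alpha) Hn hgamma Ha Hs)
      as [k [Hk|Hk]].
    + apply (slow_asymptotics (INR N) gamma alpha (T alpha) (f alpha) rho k);
        trivial; apply Hs.
    + exfalso. destruct (Hak k) as [Hp [Hno Hyes]].
      destruct (Rtotal_order alpha (a k)) as [H|[H|H]].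
      * apply (tail_fast_unique (INR N) gamma T k alpha (a k)); trivial.
      * apply (Hne k H).
      * apply (tail_fast_unique (INR N) gamma T k (a k) alpha); trivial.
Qed.
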